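(* Let $M\geq 0$ and $0\leq\theta\leq \pi/2$ be fixed real numbers. Let $r\in\mathbb{R}$ with $|r|\leq M$, let $y>0$ be real, put $t = y\sin\theta$ and $\nu = r+it$. Then, as $y\to\infty$, $$K_\nu(y) = \begin{cases} \sqrt{\dfrac{\pi}{2 y \cos \theta}}\,e^{-y (\cos \theta +\theta \sin \theta )}e^{ir\theta} +O\left(y^{-3/2}e^{-y (\cos \theta +\theta \sin \theta )} \right)& \text{ if } 0 \leq \theta < \frac \pi 2, \\[2mm] e^{-\frac \pi 2 y +i\frac \pi 2 r}\,y^{-1/3}\,\dfrac{\Gamma(\frac 1 3)} {2^{2/3}3^{1/6}} +O\left(y^{-2/3}e^{-\frac \pi 2 y +i\frac \pi 2 r} \right)& \text{ if } \theta = \frac \pi 2.\end{cases}$$ The implied constants depend on $\theta$ and $M$ in the case $0\leq\theta<\frac\pi2$ and on $M$ in the case $\theta=\frac\pi2$.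
   Context: $K_\nu$ denotes the $K$-Bessel function (modified Bessel function of the second kind), for $y>0$ and $\nu\in\mathbb{C}$ given by $K_\nu(y)=\frac12\int_{-\infty}^{\infty} e^{-y\cosh R+\nu R}\,dR$. $\Gamma(\cdot)$ is the gamma function. *)

(* Defs.v *)
From HB Require Import structures.
From mathcomp Require Import all_boot all_order all_algebra.
From mathcomp Require Import all_classical all_reals all_analysis.
From mathcomp Require Import complex.
Set Implicit Arguments.
Unset Strict Implicit.
Unset Printing Implicit Defensive.
Import Order.TTheory GRing.Theory Num.Theory.
Import numFieldNormedType.Exports.
Local Open Scope classical_set_scope.
Local Open Scope complex_scope.
Local Open Scope ring_scope.

Definition cosh (R : realType) (x : R) : R := (expR x + expR (- x)) / 2.

Definition cexp (R : realType) (z : R[i]) : R[i] :=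
  (expR (complex.Re z) * cos (complex.Im z)) +i*
  (expR (complex.Re z) * sin (complex.Im z)).

(* Meaningful when the real and imaginary parts of f are both integrable;
   [Rintegral] takes the value 0 on real integrals that are not finite. *)
Definition cintegral (R : realType) (D : set R) (f : R -> R[i]) : R[i] :=
  (\int[@lebesgue_measure R]_(x in D) complex.Re (f x)) +i*
  (\int[@lebesgue_measure R]_(x in D) complex.Im (f x)).

(* For y > 0 the integrand decays doubly exponentially, so the Lebesgue
   integral coincides with the absolutely convergent improper one. *)
Definition besselK (R : realType) (nu : R[i]) (y : R) : R[i] :=
  2^-1 * cintegral setT (fun u : R => cexp (- (y * cosh u)%:C + nu * u%:C)).

(* Euler's integral: this is the gamma function on positive reals only. *)
Definition Gamma (R : realType) (x : R) : R :=
  \int[@lebesgue_measure R]_(u in `]0, +oo[) (powR u (x - 1) * expR (- u)).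

(* f r y = O(g r y) as y --> +oo, with one implied constant (and one
   threshold on y) for all real r with |r| <= M. *)
Definition bigO_unif (R : realType) (M : R) (f g : R -> R -> R[i]) : Prop :=
  exists C : R, \forall y \near +oo%R, forall r : R, `|r| <= M ->
    `|f r y| <= C%:C * `|g r y|.

(* Main.v *)
Require Import Defs.
From HB Require Import structures.
From mathcomp Require Import all_boot all_order all_algebra.
From mathcomp Require Import all_classical all_reals all_analysis.
From mathcomp Require Import complex.
From mathcomp Require Import measurable_realfun.
From mathcomp Require Import ring lra.
Import Order.TTheory GRing.Theory Num.Theory.
Import numFieldNormedType.Exports.
Local Open Scope classical_set_scope.
Local Open Scope complex_scope.
Local Open Scope ring_scope.
Set Implicit Arguments.
Unset Strict Implicit.
Unset Printing Implicit Defensive.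

(** The function K_nu(y) is half the integral over the real line of the entire
    function f(z) = exp(- y cosh z + nu z).  With nu = r + i y sin theta the
    large part y (- cosh z + i z sin theta) of the exponent is stationary at
    z = i theta, so the real line is moved upwards.  By Cauchy's theorem every
    height p with 0 <= p < pi / 2 is admissible, and folding the line at its
    midpoint gives [besselK_shift]:
      K_(r + i t)(y) = exp (- t p + i r p) (X + i Y),
    where X and Y are the integrals over u >= 0 of
      exp (- y cos p cosh u) cosh (r u) cos (t u - y sin p sinh u),
      exp (- y cos p cosh u) sinh (r u) sin (t u - y sin p sinh u).

    If theta < pi / 2, take p = theta.  At the scale u = v / sqrt y the
    integrand of X is exp (- y cos theta) times the Gaussian
    exp (- cos theta v^2 / 2), up to a relative error O(1 / y) only: the
    corrections of order 1 / sqrt y are odd in u, and the folding has already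
    cancelled them.  This also makes Y negligible ([laplace_integrals]).

    If theta = pi / 2, the second derivative of the exponent vanishes at the
    stationary point, which lies on the excluded line p = pi / 2.  Take
    instead p = pi / 2 - e with e = y^(-1/3).  At the scale u = e v the factor
    exp (- y sin e cosh u) still is a Gaussian of width of order 1, and the
    integrand tends, with an error O(e), to the real part of
    exp (- i (v - i)^3 / 6) ([airy_integrals]).  Rotating the line Im z = -1
    onto the ray arg z = - pi / 6, on which - i z^3 is real and negative,
    turns the limit into an integral of exp (- c v^3), which is a value of
    the Gamma function ([airy_constant]).

    Both deformations are instances of one real-variable statement,
    [green_integral0y].  If z(s, u) is a family of paths, the functions
    P = Re (f(z) dz/du) and Q = Re (f(z) dz/ds) satisfy dP/ds = dQ/du because
    f is holomorphic; hence the integral of P over u >= 0 does not depend on s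
    as soon as Q vanishes at both ends. *)

(** * Integrals over the half line *)

Section HalfLine.
Context {R : realType}.
Implicit Types (f g h : R -> R).

Lemma scale_ge0_integral0y (a : R) f : 0 < a -> continuous f ->
  (forall x, 0 <= f x) ->
  (\int[lebesgue_measure]_(x in `[0%R, +oo[) (f x)%:E =
   \int[lebesgue_measure]_(x in `[0%R, +oo[) (a * f (a * x))%:E)%E.
Proof.
move=> a0 cf f0.
have dE : (fun x : R => a * x)^`()%classic = cst a.
  apply/funext => x; rewrite derive1E.
  rewrite (_ : (fun x => a * x) = (a \*: id)); last by apply/funext.
  by rewrite deriveZ//= derive_id /GRing.scale/= mulr1.
have := @increasing_ge0_integration_by_substitutiony R (fun x => a * x) f 0.
rewrite /= mulr0 => ->.
- by apply: eq_integral => x _; rewrite dE/= mulrC.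
- by move=> x y _ _ xy; rewrite ltr_pM2l.
- by rewrite dE => x _; apply: cst_continuous.
- by rewrite dE; apply: is_cvg_cst.
- by rewrite dE; apply: is_cvg_cst.
- split => //=.
  by apply: cvg_at_right_filter; apply: cvgM; [exact: cvg_cst|exact: cvg_id].
- by apply: gt0_cvgMry.
- exact: continuous_subspaceT.
- by move=> x _; exact: f0.
Qed.

(** A change of variables known for nonnegative functions extends to signed
    ones, integrable or not: an integral is by definition the difference of the
    integrals of the positive and negative parts, and these are continuous. *)
Lemma ge0_substitution_Rintegral (D E : set R) (phi : R -> R) (c : R) : 0 <= c ->
  (forall f, continuous f -> (forall x, 0 <= f x) ->
    (\int[lebesgue_measure]_(x in D) (f x)%:E =
     \int[lebesgue_measure]_(x in E) (c * f (phi x))%:E)%E) ->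
  forall f, continuous f ->
  \int[lebesgue_measure]_(x in D) f x =
  \int[lebesgue_measure]_(x in E) (c * f (phi x)).
Proof.
move=> c0 sub f cf.
have max0 g : continuous g ->
    (\int[lebesgue_measure]_(x in D) (Num.max (g x) 0)%:E =
     \int[lebesgue_measure]_(x in E) (Num.max (c * g (phi x)) 0)%:E)%E.
  move=> cg; rewrite (sub (fun x => Num.max (g x) 0)).
  - by apply: eq_integral => x _; rewrite maxr_pMr// mulr0.
  - by apply: (max_fun_continuous cg) => x; exact: cst_continuous.
  - by move=> x; rewrite le_max lexx orbT.
rewrite /Rintegral integralE [in RHS]integralE; congr (fine (_ - _)%E).
- transitivity (\int[lebesgue_measure]_(x in D) (Num.max (f x) 0)%:E)%E.
    by apply: eq_integral => x _; rewrite funeposE -EFin_max.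
  by rewrite max0//; apply: eq_integral => x _; rewrite funeposE -EFin_max.
- transitivity (\int[lebesgue_measure]_(x in D) (Num.max (- f x) 0)%:E)%E.
    by apply: eq_integral => x _; rewrite funenegE -EFinN -EFin_max.
  rewrite (max0 (fun x => - f x)).
    by apply: eq_integral => x _; rewrite funenegE -EFinN -EFin_max mulrN.
  by move=> x; apply: continuousN; exact: cf.
Qed.

Lemma scale_Rintegral0y (a : R) f : 0 < a -> continuous f ->
  \int[lebesgue_measure]_(x in `[0%R, +oo[) f x =
  \int[lebesgue_measure]_(x in `[0%R, +oo[) (a * f (a * x)).
Proof.
move=> a0; apply: ge0_substitution_Rintegral; first exact: ltW.
by move=> g cg g0; exact: scale_ge0_integral0y.
Qed.

Lemma oppr_RintegralNy0 f : continuous f ->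
  \int[lebesgue_measure]_(x in `]-oo, 0%R]) f x =
  \int[lebesgue_measure]_(x in `[0%R, +oo[) f (- x).
Proof.
move=> cf.
rewrite (@ge0_substitution_Rintegral _ `[0%R, +oo[%classic -%R 1)//.
  by apply: eq_Rintegral => x _; rewrite mul1r.
move=> g cg g0; rewrite -{1}oppr0 ge0_integration_by_substitutionNy//.
- by apply: eq_integral => x _; rewrite mul1r.
- exact: continuous_subspaceT.
Qed.

Definition integrable0y f : Prop :=
  lebesgue_measure.-integrable `[0%R, +oo[ (EFin \o f).

Definition integral0y f : R := \int[lebesgue_measure]_(x in `[0%R, +oo[) f x.

Lemma in0y (x : R) : (`[0%R, +oo[%classic x) = (0 <= x) :> Prop.
Proof. by rewrite /= in_itv/= andbT. Qed.

Lemma le_integrable0y f g : continuous f ->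
  (forall x, 0 <= x -> `|f x| <= g x) -> integrable0y g -> integrable0y f.
Proof.
move=> cf fg; apply: le_integrable => //.
  apply/measurable_EFinP; apply: measurable_funTS.
  exact: continuous_measurable_fun.
move=> x; rewrite in0y => x0; rewrite /= lee_fin.
by rewrite (le_trans (fg x x0))// ler_norm.
Qed.

Lemma integrable0yZ (c : R) f :
  integrable0y f -> integrable0y (fun x => c * f x).
Proof. exact: (@integrableZl _ _ _ lebesgue_measure _ _ c (EFin \o f)). Qed.

Lemma continuous_expR_quadratic (C L k : R) :
  continuous (fun v => C * expR (L * v - k * v ^+ 2)).
Proof.
move=> v; apply: cvgM; first exact: cvg_cst.
apply: continuous_comp; last exact: continuous_expR.
apply: cvgB; apply: cvgM; [exact: cvg_cst|exact: cvg_id|exact: cvg_cst|].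
exact: exprn_continuous.
Qed.

(** The dominating functions of the whole development: completing the square
    compares them with a rescaled Gaussian. *)
Lemma integrable0y_gauss (C L k : R) : 0 < k ->
  integrable0y (fun v => C * expR (L * v - k * v ^+ 2)).
Proof.
move=> k0; pose a := Num.sqrt (k / 2).
have a0 : 0 < a by rewrite sqrtr_gt0 divr_gt0.
have a2 : a ^+ 2 = k / 2 by rewrite sqr_sqrtr// ltW// divr_gt0.
have ig : integrable0y (fun v => a * gauss_fun (a * v)).
  apply/integrableP; split.
    apply/measurable_EFinP; apply: measurable_funTS.
    apply: continuous_measurable_fun => x.
    apply: cvgM; first exact: cvg_cst.
    apply: continuous_comp; last exact: continuous_gauss_fun.
    by apply: cvgM; [exact: cvg_cst|exact: cvg_id].
  apply/abse_integralP => //.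
    apply/measurable_EFinP; apply: measurable_funTS.
    apply: continuous_measurable_fun => x.
    apply: cvgM; first exact: cvg_cst.
    apply: continuous_comp; last exact: continuous_gauss_fun.
    by apply: cvgM; [exact: cvg_cst|exact: cvg_id].
  rewrite -(scale_ge0_integral0y a0 continuous_gauss_fun gauss_fun_ge0).
  by rewrite integral0y_gauss ltry.
apply: (@le_integrable0y _
    (fun v => `|C| * expR (L ^+ 2 / (2 * k)) / a * (a * gauss_fun (a * v)))).
- exact: continuous_expR_quadratic.
- move=> v v0; rewrite normrM (ger0_norm (expR_ge0 _)) -!mulrA ler_wpM2l//.
  rewrite mulKf ?gt_eqF// /gauss_fun -expRD ler_expR exprMn a2.
  rewrite -subr_ge0 (_ : _ - _ = (L - k * v) ^+ 2 / (2 * k)).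
    by rewrite divr_ge0 ?sqr_ge0// mulr_ge0// ltW.
  by field; rewrite gt_eqF.
- exact: integrable0yZ.
Qed.

Lemma dist_integral0y f g h :
  integrable0y f -> integrable0y g -> integrable0y h ->
  (forall x, 0 <= x -> `|f x - g x| <= h x) ->
  `|integral0y f - integral0y g| <= integral0y h.
Proof.
move=> intf intg inth fgh; rewrite /integral0y -RintegralB//.
have ifg : integrable0y (fun x => f x - g x).
  by rewrite /integrable0y (_ : _ \o _ = (EFin \o f) \- (EFin \o g))%E//
    integrableB.
apply: (le_trans (le_normr_Rintegral _ ifg)) => //.
apply: le_Rintegral => //.
  exact: integrable_norm.
by move=> x; rewrite in0y; exact: fgh.
Qed.

(** Folding the real line at the origin cancels odd integrands. *)
Lemma integralT_half f : continuous f ->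
  integrable0y f -> integrable0y (fun x => f (- x)) ->
  \int[lebesgue_measure]_x f x = integral0y (fun x => f x + f (- x)).
Proof.
move=> cf i1 i2; rewrite /integral0y RintegralD//.
have mf (D : set R) : measurable_fun D (EFin \o f).
  apply/measurable_EFinP; apply: measurable_funTS.
  exact: continuous_measurable_fun.
have iN : lebesgue_measure.-integrable `]-oo, 0%R] (EFin \o f).
  apply/integrableP; split; first exact: mf.
  have := @ge0_integration_by_substitutionNy R (fun x => `|f x|) 0.
  rewrite oppr0 /= => ->.
  - by case/integrableP : i2.
  - by apply: continuous_subspaceT => x; apply: cvg_norm; exact: cf.
  - by [].
have iP : lebesgue_measure.-integrable `]0%R, +oo[ (EFin \o f).
  apply: integrableS i1 => //.
  by apply: subset_itvr; rewrite bnd_simp.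
have TE : [set: R] = `]-oo, 0%R]%classic `|` `]0%R, +oo[%classic.
  apply/seteqP; split => x //= _; rewrite !in_itv/= andbT.
  by case: (leP x 0) => h; [left|right].
rewrite TE Rintegral_setU//=.
- by rewrite oppr_RintegralNy0// Rintegral_itv_obnd_cbnd// addrC.
- rewrite -TE; apply/integrableP; split; first exact: mf.
  rewrite TE ge0_integral_setU//=.
  + by rewrite lte_add_pinfty//; [case/integrableP : iN|case/integrableP : iP].
  + apply/measurable_EFinP; apply: measurable_funTS.
    by apply: continuous_measurable_fun => x; apply: cvg_norm; exact: cf.
  + apply/disj_setPS => x [] /=; rewrite !in_itv/= andbT => h1 h2.
    by have := le_lt_trans h1 h2; rewrite ltxx.
- apply/disj_setPS => x [] /=; rewrite !in_itv/= andbT => h1 h2.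
  by have := le_lt_trans h1 h2; rewrite ltxx.
Qed.

(** The derivative may change sign, so the integrals over [0, n] converge by
    dominated rather than by monotone convergence. *)
Lemma FTC_integral0y (Q D : R -> R) :
  (forall x, is_derive x (1:R) Q (D x)) -> continuous D -> integrable0y D ->
  Q x @[x --> +oo] --> (0:R) ->
  integral0y D = - Q 0.
Proof.
move=> dQ cD iD Q0.
pose I n := \int[lebesgue_measure]_(x in `[0%R, n%:R]) D x.
have cQ : continuous Q.
  by move=> x; apply: differentiable_continuous; apply/derivable1_diffP; apply: ex_derive.
have IE n : I n.+1 = Q n.+1%:R - Q 0.
  rewrite /I /Rintegral (@continuous_FTC2 R D Q)//.
  - exact: continuous_subspaceT.
  - split.
    + by move=> x _; apply: ex_derive.
    + by apply: cvg_at_right_filter; exact: cQ.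
    + by apply: cvg_at_left_filter; exact: cQ.
  - by move=> x _; rewrite derive1E derive_val.
have lim1 : I n @[n --> \oo] --> - Q 0.
  have Qn : Q n.+1%:R @[n --> \oo] --> (0:R).
    rewrite (cvg_shiftS (fun n => Q n%:R)).
    by move/cvg_pinftyP : Q0; apply; exact: cvgr_idn.
  have : Q n.+1%:R - Q 0 @[n --> \oo] --> 0 - Q 0.
    by apply: cvgB; [exact: Qn|exact: cvg_cst].
  by rewrite sub0r -(cvg_shiftS I) (funext IE).
have lim2 : I n @[n --> \oo] --> integral0y D.
  have mD (A : set R) : measurable_fun A (EFin \o D).
    apply/measurable_EFinP; apply: measurable_funTS.
    exact: continuous_measurable_fun.
  pose F (n : nat) := (EFin \o D) \_ `[0%R, n%:R].
  have IF n : (\int[lebesgue_measure]_(x in `[0%R, +oo[) F n x =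
      \int[lebesgue_measure]_(x in `[0%R, n%:R]) (D x)%:E)%E.
    rewrite -integral_mkcondr setIidr//.
    by apply: subset_itvl; rewrite bnd_simp.
  have : (\int[lebesgue_measure]_(x in `[0%R, +oo[) F n x)%E @[n --> \oo] -->
      (\int[lebesgue_measure]_(x in `[0%R, +oo[) (D x)%:E)%E.
    apply: (@dominated_cvg _ _ R lebesgue_measure `[0%R, +oo[%classic _
      F (EFin \o D) (abse \o (EFin \o D))) => //.
    - move=> n; by apply/(measurable_restrict _) => //; exact: mD.
    - move=> x; rewrite in0y => x0; apply: cvg_near_cst.
      near=> n; rewrite /F patchE mem_set//= in_itv/= x0/=.
      near: n; exact: nbhs_infty_ger.
    - exact: integrable_norm.
    - move=> n x _; rewrite /F patchE; case: ifP => _ /=; first by [].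
      by rewrite normr0 lee_fin.
  under eq_fun do rewrite IF.
  move=> cvI; have fD : (\int[lebesgue_measure]_(x in `[0%R, +oo[) (D x)%:E)%E
    \is a fin_num by exact: integrable_fin_num.
  by move: cvI; rewrite -(fineK fD) => /fine_cvg.
exact: (cvg_unique _ lim2 lim1).
Unshelve. all: by end_near. Qed.

(** * Deformation of paths *)

(** Differentiating under the integral sign, the derivative in s of the
    integral of P s is the integral of D s = d(Q s)/du, that is, the difference
    of the boundary values of Q s.  For f holomorphic, P and Q will be the
    components of the closed form Re (f(z) dz) in the coordinates (u, s). *)
Lemma green_integral0y (a b : R) (P D Q : R -> R -> R) (G : R -> R) :
  (forall s, a < s < b -> integrable0y (P s)) ->
  (forall s u, a < s < b -> is_derive s (1:R) (P ^~ u) (D s u)) ->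
  (forall s u, a < s < b -> is_derive u (1:R) (Q s) (D s u)) ->
  (forall s, a < s < b -> continuous (D s)) ->
  (forall s u, a < s < b -> 0 <= u -> `|D s u| <= G u) ->
  (forall u, 0 <= G u) -> integrable0y G ->
  (forall s, a < s < b -> Q s 0 = 0) ->
  (forall s, a < s < b -> Q s u @[u --> +oo] --> (0:R)) ->
  forall s t, a < s < b -> a < t < b -> integral0y (P s) = integral0y (P t).
Proof.
move=> iP dP dQ cD DG G0 iG Q0 Qy.
pose F s := integral0y (P s).
have dF s : a < s < b -> is_derive s (1:R) F 0.
  move=> sab.
  have E u x : a < x < b -> partial1of2 P x u = D x u.
    move=> xab; rewrite /partial1of2 derive1E.
    by have := dP x u xab => ?; rewrite derive_val.
  have sI : `]a, b[%classic s by rewrite /= in_itv.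
  have ci x : `]a, b[%classic x ->
      lebesgue_measure.-integrable `[0%R, +oo[ (EFin \o P x).
    by rewrite /= in_itv; exact: iP.
  have cd x u : `]a, b[%classic x -> `[0%R, +oo[%classic u ->
      derivable (P ^~ u) x 1.
    rewrite /= in_itv => xab _.
    by have := dP x u xab => ?; exact: ex_derive.
  have cG x u : `]a, b[%classic x -> `[0%R, +oo[%classic u ->
      `|partial1of2 P x u| <= G u.
    by rewrite in0y /= in_itv/= => xab u0; rewrite E// DG.
  have dF := @derivable_under_integral R _ _ (@lebesgue_measure R) P _
    (measurable_itv _) s a b sI ci cd G G0 iG cG.
  have := @differentiation_under_integral R _ _ (@lebesgue_measure R) P _
    (measurable_itv _) s a b sI ci cd G G0 iG cG.
  have -> : \int[lebesgue_measure]_(u in `[0%R, +oo[) partial1of2 P s u = 0.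
    transitivity (integral0y (D s)).
      by apply: eq_Rintegral => u _; rewrite E.
    rewrite (FTC_integral0y (fun u => dQ s u sab) (cD s sab) _ (Qy s sab)).
      by rewrite Q0// oppr0.
    by apply: le_integrable0y iG; [exact: cD|move=> u u0; exact: DG].
  by rewrite derive1E => dF0; split; [exact: dF|].
have cst s t : a < s -> s < t -> t < b -> F s = F t.
  move=> as_ st tb.
  have I x : x \in `[s, t] -> a < x < b.
    rewrite in_itv/= => /andP[h1 h2].
    by rewrite (lt_le_trans as_ h1) (le_lt_trans h2 tb).
  have [||c _] := @MVT R F (cst 0) _ _ st.
  - by move=> x xst; apply: dF; apply: I; exact: subset_itv_oo_cc xst.
  - apply: derivable_within_continuous => x xst.
    by have := dF x (I x xst) => ?; exact: ex_derive.
  by rewrite /= mul0r => /eqP; rewrite subr_eq0 => /eqP.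
move=> s t /andP[as_ sb] /andP[at_ tb].
by have [st|st|->//] := ltgtP s t; [exact: cst|exact: esym (cst t s at_ st sb)].
Qed.

(** * Derivatives and elementary inequalities *)

(** Not a class, unlike [is_derive]: the derivative is then found by following
    the syntax of the function, which is what the tactic [derive] does. *)
Definition der f (x d : R) : Prop := is_derive x (1:R) f d.

Lemma der_cst (c x : R) : der (fun=> c) x 0.
Proof. exact: is_derive_cst. Qed.

Lemma der_id (x : R) : der (fun y => y) x 1.
Proof. exact: is_derive_id. Qed.

Lemma der_add f g (x a b : R) : der f x a -> der g x b ->
  der (fun y => f y + g y) x (a + b).
Proof. exact: is_deriveD. Qed.

Lemma der_opp f (x a : R) : der f x a -> der (fun y => - f y) x (- a).
Proof. exact: is_deriveN. Qed.

Lemma der_mul f g (x a b : R) : der f x a -> der g x b ->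
  der (fun y => f y * g y) x (a * g x + f x * b).
Proof.
move=> df dg; apply: (is_derive_eq (is_deriveM df dg)).
by rewrite /GRing.scale/= addrC (mulrC a).
Qed.

Lemma der_exp f (x a : R) n : der f x a ->
  der (fun y => f y ^+ n.+1) x (n.+1%:R * f x ^+ n * a).
Proof.
rewrite /der => df; have -> : (fun y => f y ^+ n.+1) = f ^+ n.+1.
  by apply/funext => y; rewrite exprfctE.
exact: is_derive_eq.
Qed.

Lemma der_comp h f (x a b : R) : der h (f x) b -> der f x a ->
  der (fun y => h (f y)) x (b * a).
Proof. exact: is_derive1_comp. Qed.

Lemma der_expR f (x a : R) : der f x a ->
  der (fun y => expR (f y)) x (expR (f x) * a).
Proof. by apply: der_comp; exact: is_derive_expR. Qed.

Lemma der_cos f (x a : R) : der f x a ->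
  der (fun y => cos (f y)) x (- sin (f x) * a).
Proof. by apply: der_comp; exact: is_derive_cos. Qed.

Lemma der_sin f (x a : R) : der f x a ->
  der (fun y => sin (f y)) x (cos (f x) * a).
Proof. by apply: der_comp; exact: is_derive_sin. Qed.

Lemma der_eq f (x a b : R) : der f x a -> a = b -> der f x b.
Proof. by move=> + <-. Qed.

Lemma der_continuous f (x a : R) : der f x a -> {for x, continuous f}.
Proof.
rewrite /der => df; apply: differentiable_continuous; apply/derivable1_diffP.
exact: ex_derive.
Qed.

Definition sinh (x : R) : R := (expR x - expR (- x)) / 2.

Lemma der_cosh_sinh (x : R) : der (@cosh R) x (sinh x) /\ der sinh x (cosh x).
Proof.
split; (apply: der_eq; [apply: der_mul; last exact: der_cst;
    apply: der_add; [|try apply: der_opp]; apply: der_expR;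
    try apply: der_opp; exact: der_id|rewrite /cosh /sinh; by field]).
Qed.

Lemma der_sinh f (x a : R) : der f x a ->
  der (fun y => sinh (f y)) x (cosh (f x) * a).
Proof. by apply: der_comp; case: (der_cosh_sinh (f x)). Qed.

Lemma der_cosh f (x a : R) : der f x a ->
  der (fun y => cosh (f y)) x (sinh (f x) * a).
Proof. by apply: der_comp; case: (der_cosh_sinh (f x)). Qed.

Ltac derive_step := first [ apply: der_cst | apply: der_id | apply: der_expR
  | apply: der_cos | apply: der_sin | apply: der_sinh | apply: der_cosh
  | apply: der_exp | apply: der_add | apply: der_opp | apply: der_mul ].
Ltac derive := apply: der_eq; [by repeat derive_step|rewrite /=].
Ltac cont := by move=> ?; apply: der_continuous; repeat derive_step.

(** Applied repeatedly, this gives all the Taylor bounds below. *)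
Lemma ler_der f g (df dg : R -> R) :
  (forall x, der f x (df x)) -> (forall x, der g x (dg x)) ->
  (forall x, 0 <= x -> df x <= dg x) -> f 0 <= g 0 ->
  forall x, 0 <= x -> f x <= g x.
Proof.
move=> Df Dg dfg fg0 x x0.
have Dh z : der (fun y => g y - f y) z (dg z - df z).
  by apply: der_add => //; exact: der_opp.
have [c] := @MVT_segment R _ _ _ _ x0 (fun z _ => Dh z)
  (continuous_subspaceT (fun z => der_continuous (Dh z))).
rewrite in_itv/= => /andP[c0 _] E.
rewrite -subr_ge0; have : 0 <= (dg c - df c) * (x - 0).
  by rewrite mulr_ge0 ?subr0// subr_ge0 dfg.
by rewrite -E; lra.
Qed.

Lemma lipschitz_der f (df : R -> R) :
  (forall x, der f x (df x)) -> (forall x, `|df x| <= 1) ->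
  forall x y, `|f x - f y| <= `|x - y|.
Proof.
move=> Df df1.
suff le x y : x <= y -> `|f y - f x| <= `|y - x|.
  by move=> x y; have [/le|/ltW/le//] := leP x y; rewrite distrC (distrC y).
move=> xy; have [c _ ->] := @MVT_segment R _ _ _ _ xy (fun z _ => Df z)
  (continuous_subspaceT (fun z => der_continuous (Df z))).
by rewrite normrM ler_piMl.
Qed.

Lemma dist_cos (x y : R) : `|cos x - cos y| <= `|x - y|.
Proof.
apply: (@lipschitz_der _ (fun z => - sin z)) => z; first exact: is_derive_cos.
by rewrite normrN ler_norml sin_geN1 sin_le1.
Qed.

Lemma dist_sin (x y : R) : `|sin x - sin y| <= `|x - y|.
Proof.
apply: (@lipschitz_der _ cos) => z; first exact: is_derive_sin.
by rewrite ler_norml cos_geN1 cos_le1.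
Qed.

Lemma normr_sin_le (x : R) : `|sin x| <= `|x|.
Proof. by have := dist_sin x 0; rewrite sin0 !subr0. Qed.

Lemma dist_expR (a b K : R) : expR a <= K -> expR b <= K ->
  `|expR a - expR b| <= `|a - b| * K.
Proof.
move=> aK bK.
have h (x y : R) : expR x <= K -> expR x - expR y <= `|x - y| * K.
  move=> xK; apply: (@le_trans _ _ ((x - y) * expR x)).
    have := ler_wpM2r (expR_ge0 x) (expR_ge1Dx (y - x)).
    by rewrite -expRD subrK; lra.
  have [xy|xy] := leP 0 (x - y).
    by rewrite ger0_norm// ler_wpM2l.
  rewrite (@le_trans _ _ 0)//; first by rewrite nmulr_rle0 ?expR_ge0.
  by rewrite mulr_ge0// (le_trans (expR_ge0 _) xK).
by rewrite ler_norml lerNl opprB {1}distrC !h.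
Qed.

Lemma sin_le_id (x : R) : 0 <= x -> sin x <= x.
Proof.
move: x; apply: ler_der => [x|x|x _|].
- exact: is_derive_sin.
- exact: der_id.
- exact: cos_le1.
- by rewrite sin0.
Qed.

Lemma cos_ge_quad (x : R) : 0 <= x -> 1 - x ^+ 2 / 2 <= cos x.
Proof.
move: x; apply: (ler_der (df := fun x => - x) (dg := fun x => - sin x)) => [x|x|x x0|].
- by derive; field.
- exact: is_derive_cos.
- by rewrite lerN2 sin_le_id.
- by rewrite cos0; lra.
Qed.

Lemma sin_ge_cubic (x : R) : 0 <= x -> x - x ^+ 3 / 6 <= sin x.
Proof.
move: x; apply: (ler_der (df := fun x => 1 - x ^+ 2 / 2) (dg := cos)) => [x|x|x x0|].
- by derive; field.
- exact: is_derive_sin.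
- exact: cos_ge_quad.
- by rewrite sin0; lra.
Qed.

Lemma cos_le_quartic (x : R) : 0 <= x -> cos x <= 1 - x ^+ 2 / 2 + x ^+ 4 / 24.
Proof.
move: x; apply: (ler_der (df := fun x => - sin x)
  (dg := fun x => - x + x ^+ 3 / 6)) => [x|x|x x0|].
- exact: is_derive_cos.
- by derive; field.
- by have := sin_ge_cubic x0; lra.
- by rewrite cos0; lra.
Qed.

Lemma sin_le_quintic (x : R) : 0 <= x -> sin x <= x - x ^+ 3 / 6 + x ^+ 5 / 120.
Proof.
move: x; apply: (ler_der (df := cos)
  (dg := fun x => 1 - x ^+ 2 / 2 + x ^+ 4 / 24)) => [x|x|x x0|].
- exact: is_derive_sin.
- by derive; field.
- exact: cos_le_quartic.
- by rewrite sin0; lra.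
Qed.

Lemma cosh_ge1 (x : R) : 0 <= x -> 1 <= cosh x.
Proof.
move: x; apply: (ler_der (df := fun=> 0) (dg := sinh)) => [x|x|x x0|].
- exact: der_cst.
- by case: (der_cosh_sinh x).
- by rewrite /sinh divr_ge0// subr_ge0 ler_expR; lra.
- by rewrite /cosh oppr0 expR0; lra.
Qed.

Lemma sinh_ge_id (x : R) : 0 <= x -> x <= sinh x.
Proof.
move: x; apply: (ler_der (df := fun=> 1) (dg := @cosh R)) => [x|x|x x0|].
- exact: der_id.
- by case: (der_cosh_sinh x).
- exact: cosh_ge1.
- by rewrite /sinh oppr0 subrr mul0r.
Qed.

Lemma cosh_ge_quad (x : R) : 0 <= x -> 1 + x ^+ 2 / 2 <= cosh x.
Proof.
move: x; apply: (ler_der (df := id) (dg := sinh)) => [x|x|x x0|].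
- by derive; field.
- by case: (der_cosh_sinh x).
- exact: sinh_ge_id.
- by rewrite /cosh oppr0 expR0; lra.
Qed.

Lemma sinh_ge_cubic (x : R) : 0 <= x -> x + x ^+ 3 / 6 <= sinh x.
Proof.
move: x; apply: (ler_der (df := fun x => 1 + x ^+ 2 / 2) (dg := @cosh R)) => [x|x|x x0|].
- by derive; field.
- by case: (der_cosh_sinh x).
- exact: cosh_ge_quad.
- by rewrite /sinh oppr0 subrr mul0r; lra.
Qed.

(** A bound x ^+ n * expR x survives integration with a larger exponent,
    because the derivative of x ^+ n.+1 * expR x is at least x ^+ n * expR x for
    x >= 0.  This gives crude Taylor remainders for cosh and sinh of the right order. *)
Lemma le_exprM_expR f (df : R -> R) n :
  (forall x, der f x (df x)) -> f 0 = 0 ->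
  (forall x, 0 <= x -> df x <= x ^+ n * expR x) ->
  forall x, 0 <= x -> f x <= x ^+ n.+1 * expR x.
Proof.
move=> Df f0 dfn.
apply: (ler_der (df := df)
  (dg := fun x => n.+1%:R * x ^+ n * 1 * expR x + x ^+ n.+1 * (expR x * 1))) => //.
- by move=> x; apply: der_mul; [apply: der_exp|apply: der_expR]; exact: der_id.
- move=> x x0; apply: (le_trans (dfn x x0)).
  rewrite !mulr1 -!mulrA ler_wpDr ?mulr_ge0 ?exprn_ge0 ?expR_ge0//.
  by rewrite ler_peMl ?mulr_ge0 ?exprn_ge0 ?expR_ge0// ler1n.
- by rewrite f0 expr0n mul0r.
Qed.

Lemma cosh_le_expR (x : R) : 0 <= x -> cosh x <= expR x.
Proof.
move=> x0; rewrite /cosh; have : expR (- x) <= expR x by rewrite ler_expR; lra.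
by lra.
Qed.

Lemma sinh_le (x : R) : 0 <= x -> sinh x <= x * expR x.
Proof.
move=> x0; rewrite -{2}(expr1 x); move: x x0.
apply: (@le_exprM_expR sinh (@cosh R) 0) => [x||x x0].
- by case: (der_cosh_sinh x).
- by rewrite /sinh oppr0 subrr mul0r.
- by rewrite expr0 mul1r cosh_le_expR.
Qed.

Lemma cosh_sub1_le (x : R) : 0 <= x -> cosh x - 1 <= x ^+ 2 * expR x.
Proof.
move: x; apply: (@le_exprM_expR (fun x => cosh x - 1) sinh) => [x||x x0].
- by derive; ring.
- by rewrite /cosh oppr0 expR0; field.
- by rewrite expr1 sinh_le.
Qed.

Lemma sinh_subid_le (x : R) : 0 <= x -> sinh x - x <= x ^+ 3 * expR x.
Proof.
move: x; apply: (@le_exprM_expR (fun x => sinh x - x) (fun x => cosh x - 1)) => [x||x x0].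
- by derive; ring.
- by rewrite /sinh oppr0; ring.
- exact: cosh_sub1_le.
Qed.

Lemma cosh_subquad_le (x : R) : 0 <= x ->
  cosh x - 1 - x ^+ 2 / 2 <= x ^+ 4 * expR x.
Proof.
move: x; apply: (@le_exprM_expR (fun x => cosh x - 1 - x ^+ 2 / 2)
  (fun x => sinh x - x)) => [x||x x0].
- by derive; field.
- by rewrite /cosh oppr0 expR0; field.
- exact: sinh_subid_le.
Qed.

Lemma sinh_subcubic_le (x : R) : 0 <= x ->
  sinh x - x - x ^+ 3 / 6 <= x ^+ 5 * expR x.
Proof.
move: x; apply: (@le_exprM_expR (fun x => sinh x - x - x ^+ 3 / 6)
  (fun x => cosh x - 1 - x ^+ 2 / 2)) => [x||x x0].
- by derive; field.
- by rewrite /sinh oppr0; ring.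
- exact: cosh_subquad_le.
Qed.

(** Powers are always traded for exponentials, so that only one family of
    dominating functions is needed. *)
Lemma exprn_le_expR (x : R) n : 0 <= x -> x ^+ n <= expR (n%:R * x).
Proof.
move=> x0; rewrite mulrC expRM_natr lerXn2r ?nnegrE ?expR_ge0//.
by have := expR_ge1Dx x; lra.
Qed.

Lemma cvg_gauss_bound (C L k : R) : 0 < k ->
  C * expR (L * v - k * v ^+ 2) @[v --> +oo] --> (0:R).
Proof.
move=> k0; rewrite -(mulr0 C); apply: cvgM; first exact: cvg_cst.
apply: (@squeeze_cvgr _ _ _ _ (fun=> 0) (fun v : R => expR (- v))).
- near=> v; rewrite expR_ge0 ler_expR/=.
  have vL : (L + 1) / k <= v.
    by near: v; apply: nbhs_pinfty_ge; exact: num_real.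
  have v0 : 0 <= v by near: v; exact: nbhs_pinfty_ge.
  move: vL; rewrite ler_pdivrMr// => vL.
  have : (L + 1) * v <= v * k * v by rewrite ler_wpM2r.
  by rewrite expr2; lra.
- exact: cvg_cst.
- exact: cvgr_expR.
Unshelve. all: by end_near. Qed.

Lemma cvg0_gauss_bound f (C L k : R) : 0 < k ->
  (forall u, 0 <= u -> `|f u| <= C * expR (L * u - k * u ^+ 2)) ->
  f u @[u --> +oo] --> (0:R).
Proof.
move=> k0 fG; apply: norm_cvg0.
apply: (@squeeze_cvgr _ _ _ _ (fun=> 0)
  (fun u => C * expR (L * u - k * u ^+ 2))).
- near=> v; have v0 : 0 <= v by near: v; exact: nbhs_pinfty_ge.
  by rewrite normr_ge0/= fG.
- exact: cvg_cst.
- exact: cvg_gauss_bound.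
Unshelve. all: by end_near. Qed.

Lemma cos_ge_cos (b phi : R) : - b < phi < b -> b < pi / 2 -> cos b <= cos phi.
Proof.
move=> /andP[h1 h2] bpi.
have p0 := @pi_gt0 R.
have cn : cos phi = cos `|phi|.
  by case: (ler0P phi) => _; rewrite ?cosN.
have lb : `|phi| <= b by rewrite ler_norml !ltW.
rewrite cn leNgt ltr_cos ?in_itv/= ?normr_ge0//=.
- by rewrite -leNgt.
- by lra.
- by rewrite (le_trans lb)//; lra.
Qed.

Lemma sinh_ge0 (x : R) : 0 <= x -> 0 <= sinh x.
Proof. by move=> x0; rewrite (le_trans x0)// sinh_ge_id. Qed.

Lemma sinh_le_expR (x : R) : sinh x <= expR x.
Proof. by rewrite /sinh; have := expR_gt0 x; have := expR_gt0 (- x); lra. Qed.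

Lemma normr_cosh_sinh_le (x : R) : `|cosh x| <= expR `|x| /\ `|sinh x| <= expR `|x|.
Proof.
have e1 : expR x <= expR `|x| by rewrite ler_expR ler_norm.
have e2 : expR (- x) <= expR `|x| by rewrite ler_expR -normrN ler_norm.
have p1 := expR_gt0 x; have p2 := expR_gt0 (- x).
by split; rewrite ler_norml /cosh /sinh; apply/andP; split; lra.
Qed.

(** * Shifting the line of integration in the Bessel integral *)

(** With c = cos p and s = sin p, [kernelX] and [kernelY] are the even parts in
    u of the real and imaginary parts of exp (- y cosh z + (r + i t) z) on the
    line z = u + i p, without the constant factor exp (- t p + i r p). *)
Definition kernelX (y c s r t u : R) : R :=
  expR (- (y * c * cosh u)) * (cosh (r * u) * cos (t * u - y * s * sinh u)).

Definition kernelY (y c s r t u : R) : R :=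
  expR (- (y * c * cosh u)) * (sinh (r * u) * sin (t * u - y * s * sinh u)).

Lemma continuous_kernelX y c s r t : continuous (kernelX y c s r t).
Proof. rewrite /kernelX; cont. Qed.

Lemma continuous_kernelY y c s r t : continuous (kernelY y c s r t).
Proof. rewrite /kernelY; cont. Qed.

Lemma kernel_bound (y c r u hyp trig : R) : 0 < y -> 0 < c -> 0 <= u ->
  `|hyp| <= expR `|r * u| -> `|trig| <= 1 ->
  `|expR (- (y * c * cosh u)) * (hyp * trig)| <=
    1 * expR (`|r| * u - y * c / 2 * u ^+ 2).
Proof.
move=> y0 c0 u0 hh ht; rewrite !normrM ger0_norm ?expR_ge0// mul1r.
apply: (@le_trans _ _ (expR (- (y * c * cosh u)) * expR `|r * u|)).
  rewrite ler_wpM2l ?expR_ge0// -[leRHS]mulr1 ler_pM//.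
rewrite -expRD ler_expR normrM (ger0_norm u0) addrC lerD2l lerN2 -mulrA.
rewrite ler_wpM2l ?mulr_ge0 ?ltW//.
by have := cosh_ge_quad u0; lra.
Qed.

Lemma normr_cos_le1 (x : R) : `|cos x| <= 1.
Proof. by rewrite ler_norml cos_geN1 cos_le1. Qed.

Lemma normr_sin_le1 (x : R) : `|sin x| <= 1.
Proof. by rewrite ler_norml sin_geN1 sin_le1. Qed.

Lemma integrable_kernelX y c s r t : 0 < y -> 0 < c ->
  integrable0y (kernelX y c s r t).
Proof.
move=> y0 c0; apply: le_integrable0y (integrable0y_gauss 1 `|r| (k := y * c / 2) _).
- exact: continuous_kernelX.
- move=> u u0; apply: kernel_bound => //; last exact: normr_cos_le1.
  by case: (normr_cosh_sinh_le (r * u)).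
- by rewrite divr_gt0// mulr_gt0.
Qed.

Lemma integrable_kernelY y c s r t : 0 < y -> 0 < c ->
  integrable0y (kernelY y c s r t).
Proof.
move=> y0 c0; apply: le_integrable0y (integrable0y_gauss 1 `|r| (k := y * c / 2) _).
- exact: continuous_kernelY.
- move=> u u0; apply: kernel_bound => //; last exact: normr_sin_le1.
  by case: (normr_cosh_sinh_le (r * u)).
- by rewrite divr_gt0// mulr_gt0.
Qed.

Lemma integral0y_lin (a b : R) f g : integrable0y f -> integrable0y g ->
  integral0y (fun u => a * f u + b * g u) = a * integral0y f + b * integral0y g.
Proof.
move=> fi gi; rewrite /integral0y RintegralD//; [|exact: integrable0yZ..].
by rewrite !RintegralZl.
Qed.

(** In this section f(z) = exp (- y cosh z + (r + i t) z + i a).  The phase a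
    makes one real statement serve for both the real and the imaginary part. *)
Section BesselShift.
Variables (y r t a : R).
Hypothesis y0 : 0 < y.

(* At z = u + i p the exponent is E p u + r u + i (w p u + r p + a), where E is
   even and w is odd in u.  P is Re (f(u + i p) + f(- u + i p)) and Q is
   - Im (f(u + i p) - f(- u + i p)); folding makes Q vanish at u = 0. *)
Let E (p u : R) := - (y * cos p * cosh u) - t * p.
Let w (p u : R) := t * u - y * sin p * sinh u.
Let P (p u : R) := expR (E p u + r * u) * cos (w p u + r * p + a) +
  expR (E p u - r * u) * cos (- w p u + r * p + a).
Let Q (p u : R) := - (expR (E p u + r * u) * sin (w p u + r * p + a)) +
  expR (E p u - r * u) * sin (- w p u + r * p + a).
Let D (p u : R) :=
  expR (E p u + r * u) * ((y * sin p * cosh u - t) * cos (w p u + r * p + a)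
    - (r - y * cos p * sinh u) * sin (w p u + r * p + a)) +
  expR (E p u - r * u) * ((y * sin p * cosh u - t) * cos (- w p u + r * p + a)
    - (r + y * cos p * sinh u) * sin (- w p u + r * p + a)).

Let der_P p u : der (P ^~ u) p (D p u).
Proof. by rewrite /P /D /E /w; derive; ring. Qed.

Let der_Q p u : der (Q p) u (D p u).
Proof. by rewrite /Q /D /E /w; derive; ring. Qed.

Let continuous_P p : continuous (P p).
Proof. rewrite /P /E /w; cont. Qed.

Let continuous_D p : continuous (D p).
Proof. rewrite /D /E /w; cont. Qed.

(* For p in ]- b, b[ the integrands decay uniformly, as cos p >= cos b > 0. *)
Variable b : R.
Hypotheses (b0 : 0 < b) (bpi : b < pi / 2).

Let k := y * cos b / 2.

Let cosb : 0 < cos b.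
Proof.
apply: cos_gt0_pihalf; rewrite bpi andbT (lt_trans _ b0)// oppr_lt0.
by rewrite divr_gt0// pi_gt0.
Qed.

Let k0 : 0 < k.
Proof. by rewrite divr_gt0// mulr_gt0. Qed.

Let C := 2 * expR (`|t| * b) * (2 * y + `|t| + `|r| + 1).
Let G (u : R) := C * expR ((`|r| + 1) * u - k * u ^+ 2).

Let E_bound p u z : - b < p < b -> 0 <= u -> `|z| <= `|r| * u ->
  expR (E p u + z) <= expR (`|t| * b) * expR (`|r| * u - k * u ^+ 2).
Proof.
move=> pb u0 zu; rewrite -expRD ler_expR /E.
have h1 : - (t * p) <= `|t| * b.
  rewrite (le_trans (ler_norm _))// normrN normrM ler_wpM2l//.
  by case/andP: pb => p1 p2; rewrite ler_norml !ltW.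
have h2 : z <= `|r| * u by exact: le_trans (ler_norm _) zu.
have h3 : k * u ^+ 2 <= y * cos p * cosh u.
  rewrite /k -!mulrA ler_wpM2l ?(ltW y0)// ler_pM ?(ltW cosb)//.
  - by rewrite mulr_ge0// sqr_ge0.
  - exact: cos_ge_cos.
  - by have := cosh_ge_quad u0; lra.
by lra.
Qed.

Let expR_split u : expR ((`|r| + 1) * u - k * u ^+ 2) =
  expR (`|r| * u - k * u ^+ 2) * expR u.
Proof. by rewrite -expRD; congr expR; ring. Qed.

Let wave_pair_le p u x1 x2 : - b < p < b -> 0 <= u ->
  `|x1| <= (2 * y + `|t| + `|r| + 1) * expR u ->
  `|x2| <= (2 * y + `|t| + `|r| + 1) * expR u ->
  `|expR (E p u + r * u) * x1 + expR (E p u - r * u) * x2| <= G u.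
Proof.
move=> pb u0 h1 h2.
have term z x : `|z| <= `|r| * u -> `|x| <= (2 * y + `|t| + `|r| + 1) * expR u ->
    `|expR (E p u + z) * x| <= expR (`|t| * b) * expR (`|r| * u - k * u ^+ 2) *
      ((2 * y + `|t| + `|r| + 1) * expR u).
  move=> zu hx; rewrite normrM ger0_norm ?expR_ge0// ler_pM ?expR_ge0//.
  exact: E_bound.
have ru : `|r * u| <= `|r| * u by rewrite normrM (ger0_norm u0).
apply: (le_trans (ler_normD _ _)).
rewrite /G /C expR_split.
have := term _ _ ru h1; have := term (- (r * u)) x2.
by rewrite normrN => /(_ ru h2); lra.
Qed.

Let coeff_cos p u : - b < p < b -> 0 <= u ->
  `|y * sin p * cosh u - t| <= (y + `|t|) * expR u.
Proof.
move=> pb u0; apply: (le_trans (ler_normB _ _)).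
rewrite mulrDl lerD//.
  rewrite (normrM (y * sin p)) (normrM y) (ger0_norm (ltW y0)) -mulrA.
  rewrite ler_wpM2l ?(ltW y0)// (ger0_norm (x := cosh u)); last first.
    by rewrite (le_trans _ (cosh_ge1 u0)).
  have s1 : `|sin p| <= 1 by rewrite ler_norml sin_geN1 sin_le1.
  rewrite (le_trans _ (cosh_le_expR u0))// ler_piMl//.
  by rewrite (le_trans _ (cosh_ge1 u0)).
by rewrite ler_peMr// -expR0 ler_expR.
Qed.

Let coeff_sin p u z : - b < p < b -> 0 <= u -> `|z| <= 1 ->
  `|r + z * (y * cos p * sinh u)| <= (y + `|r|) * expR u.
Proof.
move=> pb u0 z1; apply: (le_trans (ler_normD _ _)).
rewrite mulrDl addrC lerD//.
  rewrite (_ : z * _ = y * (z * cos p * sinh u)); last by ring.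
  rewrite (normrM y) (ger0_norm (ltW y0)) ler_wpM2l ?(ltW y0)//.
  rewrite (normrM (z * cos p)) (normrM z).
  have c1 : `|cos p| <= 1 by rewrite ler_norml cos_geN1 cos_le1.
  rewrite (ger0_norm (sinh_ge0 u0)).
  rewrite (le_trans _ (sinh_le_expR u))// ler_piMl ?sinh_ge0//.
  by rewrite mulr_ile1.
by rewrite ler_peMr// -expR0 ler_expR.
Qed.

Let expR_ge1' u : 0 <= u -> 1 <= expR u :> R.
Proof. by move=> u0; rewrite -expR0 ler_expR. Qed.

Let trig_le (x u : R) : 0 <= u -> `|x| <= 1 ->
  `|x| <= (2 * y + `|t| + `|r| + 1) * expR u.
Proof.
move=> u0 x1; rewrite (le_trans x1)// -[leLHS]mulr1 ler_pM ?expR_ge1'//.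
by have := y0; have := normr_ge0 t; have := normr_ge0 r; lra.
Qed.

Let P_bound p u : - b < p < b -> 0 <= u -> `|P p u| <= G u.
Proof.
by move=> pb u0; apply: wave_pair_le => //; apply: trig_le => //; exact: normr_cos_le1.
Qed.

Let Q_bound p u : - b < p < b -> 0 <= u -> `|Q p u| <= G u.
Proof.
move=> pb u0; rewrite /Q -mulrN; apply: wave_pair_le => //.
  by apply: trig_le => //; rewrite normrN normr_sin_le1.
by apply: trig_le => //; exact: normr_sin_le1.
Qed.

Let D_bound p u : - b < p < b -> 0 <= u -> `|D p u| <= G u.
Proof.
move=> pb u0.
have lin (A B x : R) : `|A| <= (y + `|t|) * expR u -> `|B| <= (y + `|r|) * expR u ->
    `|A * cos x - B * sin x| <= (2 * y + `|t| + `|r| + 1) * expR u.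
  move=> hA hB; apply: (le_trans (ler_normB _ _)); rewrite !normrM.
  have := ler_wpM2l (normr_ge0 A) (normr_cos_le1 x).
  have := ler_wpM2l (normr_ge0 B) (normr_sin_le1 x).
  by have := expR_ge1' u0; lra.
apply: wave_pair_le => //; apply: lin; rewrite ?coeff_cos//.
  have := @coeff_sin p u (-1) pb u0; rewrite mulN1r; apply.
  by rewrite normrN normr1.
by have := @coeff_sin p u 1 pb u0; rewrite mul1r; apply; rewrite normr1.
Qed.

Lemma bessel_shift_invariant p : - b < p < b ->
  integral0y (P p) = integral0y (P 0).
Proof.
move=> pb.
have zb : - b < 0 < b by rewrite oppr_lt0 b0.
apply: (@green_integral0y (- b) b P D Q G _ _ _ _ _ _ _ _ _ p 0 pb zb).
- move=> s sb; apply: (@le_integrable0y (P s) G).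
  + exact: continuous_P.
  + by move=> u u0; exact: P_bound.
  + exact: integrable0y_gauss.
- by move=> s u _; exact: der_P.
- by move=> s u _; exact: der_Q.
- by move=> s _; exact: continuous_D.
- by move=> s u sb u0; exact: D_bound.
- move=> u; rewrite /G /C !mulr_ge0 ?expR_ge0//.
  by have := y0; have := normr_ge0 t; have := normr_ge0 r; lra.
- exact: integrable0y_gauss.
- move=> s _; have w0 : w s 0 = 0 by rewrite /w /sinh oppr0; ring.
  by rewrite /Q w0 oppr0 mulr0 addr0 subr0 addNr.
- by move=> s sb; apply: (cvg0_gauss_bound k0) => u u0; exact: Q_bound.
Qed.

(** The invariance of the folded integral, with the addition formulas expanded
    at the heights p and 0. *)
Lemma bessel_shift_combination p : - b < p < b ->
  expR (- (t * p)) * (cos (r * p + a) * integral0y (kernelX y (cos p) (sin p) r t)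
    - sin (r * p + a) * integral0y (kernelY y (cos p) (sin p) r t)) =
  cos a * integral0y (kernelX y 1 0 r t) - sin a * integral0y (kernelY y 1 0 r t).
Proof.
have PE q : - b < q < b -> integral0y (P q) =
    2 * expR (- (t * q)) * (cos (r * q + a) * integral0y (kernelX y (cos q) (sin q) r t)
    - sin (r * q + a) * integral0y (kernelY y (cos q) (sin q) r t)).
  move=> qb; have cq : 0 < cos q by exact: lt_le_trans cosb (cos_ge_cos _ _).
  rewrite mulrBr !mulrA -mulNr -integral0y_lin.
  - congr (integral0y _); apply/funext => u.
    rewrite /P /kernelX /kernelY -/(w q u) -!(addrA _ (r * q) a).
    rewrite (cosD (w q u)) (cosD (- w q u)) cosN sinN /E !expRD.
    rewrite [cosh (r * u)]/cosh [sinh (r * u)]/sinh.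
    by field.
  - exact: integrable_kernelX.
  - exact: integrable_kernelY.
move=> pb; have := bessel_shift_invariant pb.
rewrite !PE ?oppr_lt0 ?b0// cos0 sin0 !mulr0 oppr0 expR0 mulr1 add0r.
by rewrite -[_ * _ * _]mulrA => /mulfI; apply.
Qed.

End BesselShift.

Lemma cosh_opp (u : R) : cosh (- u) = cosh u.
Proof. by rewrite /cosh opprK addrC. Qed.

Lemma integralT_expR_trig (y r t : R) (trig : R -> R) : 0 < y ->
  continuous trig -> (forall x, `|trig x| <= 1) ->
  let F u := expR (- (y * cosh u) + r * u) * trig (t * u) in
  \int[lebesgue_measure]_u F u = integral0y (fun u => F u + F (- u)).
Proof.
move=> y0 ctrig trig1 F.
have cF : continuous F.
  have c1 : continuous (fun u => expR (- (y * cosh u) + r * u)) by cont.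
  have c2 : continuous (fun u : R => t * u) by cont.
  move=> u; apply: cvgM; first exact: c1.
  by apply: continuous_comp; [exact: c2|exact: ctrig].
have bound s u : `|s| = 1 -> cosh (s * u) = cosh u -> 0 <= u ->
   `|F (s * u)| <= 1 * expR (`|r| * u - y / 2 * u ^+ 2).
  move=> s1 cs u0; rewrite /F normrM ger0_norm ?expR_ge0// mul1r.
  rewrite -[leRHS]mulr1 ler_pM ?expR_ge0// ler_expR cs.
  have h1 : r * (s * u) <= `|r| * u.
    by rewrite (le_trans (ler_norm _))// !normrM s1 mul1r (ger0_norm u0).
  have h2 : y / 2 * u ^+ 2 <= y * cosh u.
    rewrite -mulrA ler_wpM2l ?(ltW y0)//.
    by have := cosh_ge_quad u0; lra.
  by lra.
have ig := integrable0y_gauss 1 `|r| (k := y / 2) (divr_gt0 y0 (ltr0Sn _ _)).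
apply: integralT_half => //.
- apply: le_integrable0y ig => // u u0.
  by have := @bound 1 u; rewrite !mul1r normr1; apply.
- apply: le_integrable0y ig => [u|u u0].
    apply: continuous_comp; last exact: cF.
    by apply: continuousN; exact: cvg_id.
  by have := @bound (-1) u; rewrite !mulN1r normrN1; apply=> //; exact: cosh_opp.
Qed.

Lemma besselK_kernel (y r t : R) : 0 < y ->
  besselK (r +i* t) y =
  integral0y (kernelX y 1 0 r t) +i* integral0y (kernelY y 1 0 r t).
Proof.
move=> y0.
have ev (u : R) : complex.Re (- (y * cosh u)%:C + (r +i* t) * u%:C) =
    - (y * cosh u) + r * u.
  by rewrite /= mulr0 subr0.
have eo (u : R) : complex.Im (- (y * cosh u)%:C + (r +i* t) * u%:C) = t * u.
  by rewrite /= mulr0 oppr0 !add0r.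
have I0 : integrable0y (kernelX y 1 0 r t) by exact: integrable_kernelX.
have J0 : integrable0y (kernelY y 1 0 r t) by exact: integrable_kernelY.
have twice f g : integrable0y g -> (forall u, f u = 2 * g u) ->
    integral0y f = 2 * integral0y g.
  move=> ig fg; rewrite /integral0y -RintegralZl//.
  by apply: eq_Rintegral => u _; rewrite fg.
have -> : besselK (r +i* t) y = 2^-1 *
   ((2 * integral0y (kernelX y 1 0 r t)) +i* (2 * integral0y (kernelY y 1 0 r t))).
  rewrite /besselK /cintegral; congr (_ * (_ +i* _)).
  - rewrite -(twice _ _ I0 (fun u => erefl)).
    under eq_Rintegral do rewrite /cexp ev eo.
    rewrite integralT_expR_trig//; [|exact: continuous_cos|exact: normr_cos_le1].
    apply: eq_Rintegral => u _.
    rewrite /kernelX cosh_opp !mulrN cosN mulr0 mul0r subr0 mulr1 !expRD.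
    by rewrite [cosh (r * u)]/cosh; field.
  - rewrite -(twice _ _ J0 (fun u => erefl)).
    under eq_Rintegral do rewrite /cexp ev eo.
    rewrite integralT_expR_trig//; [|exact: continuous_sin|exact: normr_sin_le1].
    apply: eq_Rintegral => u _.
    rewrite /kernelY cosh_opp !mulrN sinN mulr0 mul0r subr0 mulr1 !expRD.
    by rewrite [sinh (r * u)]/sinh; field.
have -> : (2^-1 : R[i]) = (2^-1)%:C by rewrite rmorphV ?unitfE// rmorph_nat.
by apply/eqP; rewrite eq_complex/= !mul0r subr0 addr0 !mulKf// !eqxx.
Qed.

(** The phases a = 0 and a = - pi / 2 in [bessel_shift_combination] are the
    real and the imaginary part of the identity.  At p = pi / 2 the factor
    cos p in the kernels vanishes and the integrals no longer converge
    absolutely. *)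
Lemma besselK_shift (y r t p : R) : 0 < y -> 0 <= p < pi / 2 ->
  besselK (r +i* t) y = cexp ((- (t * p)) +i* (r * p)) *
    (integral0y (kernelX y (cos p) (sin p) r t) +i*
     integral0y (kernelY y (cos p) (sin p) r t)).
Proof.
move=> y0 /andP[p0 ppi]; rewrite besselK_kernel//.
pose b := (p + pi / 2) / 2.
have b0 : 0 < b by rewrite /b; have := @pi_gt0 R; lra.
have bpi : b < pi / 2 by rewrite /b; lra.
have pb : - b < p < b by apply/andP; split; rewrite /b; have := @pi_gt0 R; lra.
have := bessel_shift_combination r t 0 y0 b0 bpi pb.
have := bessel_shift_combination r t (- (pi / 2)) y0 b0 bpi pb.
rewrite -[- (pi / 2)]opprK opprK cosN sinN cos_pihalf sin_pihalf.
rewrite cosB sinB cos_pihalf sin_pihalf !addr0 cos0 sin0.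
rewrite !(mulr0, mul0r, mulr1, mul1r, addr0, add0r, sub0r, subr0, mulN1r, opprK).
move=> E2 E1; apply/eqP; rewrite eq_complex /cexp /= -E1 -E2.
by apply/andP; split; apply/eqP; ring.
Qed.

(** * The Gaussian regime *)

Lemma integral0y_gauss_scaled (c : R) : 0 < c ->
  integral0y (fun v => expR (- (c / 2 * v ^+ 2))) = Num.sqrt (pi / (2 * c)).
Proof.
move=> c0; pose a := Num.sqrt (2 / c).
have a0 : 0 < a by rewrite sqrtr_gt0 divr_gt0.
have cg : continuous (fun v : R => expR (- (c / 2 * v ^+ 2))) by cont.
rewrite /integral0y (scale_Rintegral0y a0 cg).
transitivity (integral0y (fun v => a * gauss_fun v)).
  apply: eq_Rintegral => v _; rewrite /gauss_fun; congr (_ * expR (- _)).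
  rewrite exprMn sqr_sqrtr ?divr_ge0 ?ltW//; field.
  by rewrite gt_eqF.
have ig : integrable0y gauss_fun.
  apply: integrableS integrableT_gauss => //.
rewrite /integral0y RintegralZl// /Rintegral integral0y_gauss /=.
rewrite (_ : pi / (2 * c) = 2 / c * pi / 2 ^+ 2); last by field; rewrite gt_eqF.
rewrite sqrtrM ?divr_ge0 ?mulr_ge0 ?invr_ge0 ?(ltW c0) ?pi_ge0//.
by rewrite sqrtrM ?divr_ge0 ?(ltW c0)// sqrtrV// sqrtr_sqr ger0_norm ?mulrA.
Qed.

(** Both regimes compare exp * cosh * cos with a limit exp * cos, one factor at
    a time; A is an exponential with envelope g. *)
Lemma dist_three_factors (g A B H T S d1 d2 d3 : R) :
  0 <= A <= g -> `|T| <= 1 -> `|S| <= 1 ->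
  `|H - 1| <= d1 -> `|T - S| <= d2 -> `|A - B| <= d3 * g ->
  `|A * (H * T) - B * S| <= (d1 + d2 + d3) * g.
Proof.
move=> /andP[A0 Ag] T1 S1 h1 h2 h3.
have -> : A * (H * T) - B * S = A * ((H - 1) * T) + A * (T - S) + (A - B) * S by ring.
apply: (le_trans (ler_normD _ _)); rewrite (mulrDl (d1 + d2)) (mulrDl d1) lerD//.
  apply: (le_trans (ler_normD _ _)); rewrite lerD// normrM (ger0_norm A0) mulrC ler_pM//.
  by rewrite normrM -[leRHS]mulr1 ler_pM.
by rewrite normrM -[leRHS]mulr1 ler_pM.
Qed.

Lemma normr_cosh_sub1 (x : R) : `|cosh x - 1| <= x ^+ 2 * expR `|x|.
Proof.
have -> : cosh x = cosh `|x| by case: (ler0P x) => _; rewrite ?cosh_opp.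
rewrite -[x ^+ 2]ger0_norm ?sqr_ge0// normrX (ger0_norm (x := cosh `|x| - 1)).
  by rewrite cosh_sub1_le.
by rewrite subr_ge0 cosh_ge1.
Qed.

Lemma normr_sinh_le (x : R) : `|sinh x| <= `|x| * expR `|x|.
Proof.
have -> : `|sinh x| = sinh `|x|.
  case: (ler0P x) => [x0|/ltW x0]; last by rewrite ger0_norm ?sinh_ge0.
  have -> : sinh x = - sinh (- x) by rewrite /sinh opprK; ring.
  by rewrite normrN ger0_norm ?sinh_ge0// oppr_ge0.
exact: sinh_le.
Qed.

Lemma normr_cos_sub1 (x : R) : `|cos x - 1| <= x ^+ 2.
Proof.
have -> : cos x = cos `|x| by case: (ler0P x) => _; rewrite ?cosN.
rewrite -[x ^+ 2]ger0_norm ?sqr_ge0// normrX.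
have := cos_ge_quad (normr_ge0 x); have := cos_le1 `|x|.
have := sqr_ge0 `|x|.
by rewrite ler_norml => *; apply/andP; split; lra.
Qed.

(** Here e = y^(-1/2) and x = e v is the variable on the shifted line.  The
    relation y e^2 = 1 gives y x^2 = v^2, while the errors (r x)^2,
    (y (sinh x - x))^2 and y (cosh x - 1 - x^2 / 2) are all O(e^2). *)
Section Laplace.
Variables (M c s y e r v : R).
Hypotheses (c0 : 0 < c) (c1 : c <= 1) (s1 : `|s| <= 1).
Hypotheses (e0 : 0 < e) (e1 : e <= 1) (ye : y * e ^+ 2 = 1).
Hypotheses (rM : `|r| <= M) (v0 : 0 <= v).

Let M0 : 0 <= M. Proof. exact: le_trans rM. Qed.
Let y0 : 0 < y.
Proof. by have := @ltr01 R; rewrite -ye pmulr_lgt0// exprn_gt0. Qed.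
Let x := e * v.
Let x0 : 0 <= x. Proof. by rewrite mulr_ge0// ltW. Qed.
Let xv : x <= v. Proof. by rewrite ler_piMl. Qed.
Let W := expR ((M + 8) * v).
Let g := expR (- (c / 2 * v ^+ 2)).
Let A := expR (- (y * c * (cosh x - 1))).
Let q := y * s * x - y * s * sinh x.

Let quadE : c / 2 * v ^+ 2 = y * c * (x ^+ 2 / 2).
Proof.
rewrite /x exprMn (_ : y * c * _ = (y * e ^+ 2) * (c / 2 * v ^+ 2)).
  by rewrite ye mul1r.
by field.
Qed.

Let Ag : 0 <= A <= g.
Proof.
rewrite expR_ge0/= /g quadE ler_expR lerN2 ler_wpM2l ?mulr_ge0 ?(ltW y0) ?(ltW c0)//.
by have := cosh_ge_quad x0; lra.
Qed.

(* M + 8 dominates the exponents M + 2, 6 + 2, 4 + 1 and M + 5 that the error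
   terms produce. *)
Let absorb n (a : R) : n%:R + a <= M + 8 -> v ^+ n * expR (a * v) <= W.
Proof.
move=> na; apply: (@le_trans _ _ (expR (n%:R * v) * expR (a * v))).
  by rewrite ler_wpM2r ?expR_ge0// exprn_le_expR.
by rewrite -expRD ler_expR -mulrDl ler_wpM2r.
Qed.

Let rx : `|r * x| <= M * v.
Proof. by rewrite normrM (ger0_norm x0) ler_pM. Qed.

Let expR_rx : expR `|r * x| <= expR (M * v).
Proof. by rewrite ler_expR. Qed.

Let q_bound : `|q| <= e * (v ^+ 3 * expR (1 * v)).
Proof.
have -> : q = - (y * s * (sinh x - x)) by rewrite /q; ring.
rewrite normrN (normrM (y * s)) (normrM y) (ger0_norm (ltW y0)).
rewrite (ger0_norm (x := sinh x - x)) ?subr_ge0 ?sinh_ge_id//.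
apply: (@le_trans _ _ (y * 1 * (x ^+ 3 * expR (1 * v)))).
  rewrite ler_pM ?mulr_ge0 ?normr_ge0 ?(ltW y0)//.
  - by rewrite subr_ge0 sinh_ge_id.
  - by rewrite ler_wpM2l ?(ltW y0).
  - apply: (le_trans (sinh_subid_le x0)).
    by rewrite ler_wpM2l ?exprn_ge0// ler_expR mul1r.
rewrite /x exprMn mulr1 (_ : y * _ = (y * e ^+ 2) * (e * (v ^+ 3 * expR (1 * v)))).
  by rewrite ye mul1r.
by ring.
Qed.

Lemma kernelX_laplace :
  `|expR (y * c) * kernelX y c s r (y * s) x - g| <=
  e ^+ 2 * ((M ^+ 2 + 2) * expR ((M + 8) * v - c / 2 * v ^+ 2)).
Proof.
have -> : expR (y * c) * kernelX y c s r (y * s) x - g =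
    A * (cosh (r * x) * cos q) - g * 1.
  rewrite /kernelX -/q mulrA -expRD mulr1; congr (expR _ * _ - _).
  by rewrite /A; ring.
rewrite (expRD _ (- _)) -/W -/g.
rewrite (_ : e ^+ 2 * _ =
  (e ^+ 2 * (M ^+ 2 * W) + e ^+ 2 * W + e ^+ 2 * W) * g); last by ring.
apply: dist_three_factors => //.
- exact: normr_cos_le1.
- by rewrite normr1.
- apply: (le_trans (normr_cosh_sub1 _)).
  apply: (@le_trans _ _ (e ^+ 2 * (M ^+ 2 * (v ^+ 2 * expR (M * v))))).
    rewrite (_ : e ^+ 2 * _ = (M * x) ^+ 2 * expR (M * v)); last by rewrite /x; ring.
    rewrite ler_pM ?sqr_ge0 ?expR_ge0// -[leLHS]ger0_norm ?sqr_ge0// normrX.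
    have rMx : `|r * x| <= M * x by rewrite normrM (ger0_norm x0) ler_wpM2r.
    apply: lerXn2r => //; rewrite nnegrE.
    by apply: mulr_ge0.
  rewrite ler_wpM2l ?sqr_ge0// ler_wpM2l ?sqr_ge0//.
  by apply: absorb; lra.
- apply: (le_trans (normr_cos_sub1 _)).
  rewrite -[leLHS]ger0_norm ?sqr_ge0// normrX.
  apply: (@le_trans _ _ ((e * (v ^+ 3 * expR (1 * v))) ^+ 2)).
    by rewrite lerXn2r ?nnegrE ?normr_ge0 ?mulr_ge0 ?exprn_ge0 ?expR_ge0 ?(ltW e0).
  rewrite (_ : _ ^+ 2 = e ^+ 2 * (v ^+ 6 * expR (2 * v))).
    rewrite ler_wpM2l ?sqr_ge0//.
    by apply: absorb; have := M0; lra.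
  by rewrite (_ : 2 * v = 1 * v + 1 * v) ?expRD; ring.
- have [A0 Ag'] := andP Ag.
  apply: (le_trans (dist_expR (K := g) _ _)) => //.
  rewrite ler_wpM2r ?expR_ge0// quadE.
  rewrite (_ : _ - _ = - (y * c * (cosh x - 1 - x ^+ 2 / 2))); last by ring.
  rewrite normrN ger0_norm; last first.
    rewrite !mulr_ge0 ?(ltW y0) ?(ltW c0)//.
    by have := cosh_ge_quad x0; lra.
  apply: (@le_trans _ _ (y * 1 * (x ^+ 4 * expR (1 * v)))).
    rewrite ler_pM ?mulr_ge0 ?(ltW y0) ?(ltW c0)//.
    + by have := cosh_ge_quad x0; lra.
    + by rewrite ler_wpM2l ?(ltW y0).
    + apply: (le_trans (cosh_subquad_le x0)).
      by rewrite ler_wpM2l ?exprn_ge0// ler_expR mul1r.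
  rewrite (_ : y * 1 * _ =
    (y * e ^+ 2) * (e ^+ 2 * (v ^+ 4 * expR (1 * v)))); last by rewrite /x; ring.
  rewrite ye mul1r ler_wpM2l ?sqr_ge0//.
  by apply: absorb; have := M0; lra.
Qed.

(** Both sine factors are O(e), so that no main term is left. *)
Lemma kernelY_laplace :
  `|expR (y * c) * kernelY y c s r (y * s) x| <=
  e ^+ 2 * ((M ^+ 2 + 2) * expR ((M + 8) * v - c / 2 * v ^+ 2)).
Proof.
have -> : expR (y * c) * kernelY y c s r (y * s) x =
    A * (sinh (r * x) * sin q).
  rewrite /kernelY -/q mulrA -expRD; congr (expR _ * _).
  by rewrite /A; ring.
rewrite (expRD _ (- _)) -/W -/g.
have [A0 Ag'] := andP Ag.
rewrite (normrM A) (normrM (sinh _)) (ger0_norm A0).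
apply: (@le_trans _ _ (g * (e ^+ 2 * (M * W)))); last first.
  rewrite (_ : e ^+ 2 * (_ * (W * g)) = g * (e ^+ 2 * ((M ^+ 2 + 2) * W))); last by ring.
  rewrite ler_wpM2l ?expR_ge0// ler_wpM2l ?sqr_ge0// ler_wpM2r ?expR_ge0//.
  by have := sqr_ge0 (M - 1); have := sqr_ge0 M; lra.
rewrite ler_pM ?mulr_ge0//.
apply: (@le_trans _ _ (e * (M * v * expR (M * v)) * (e * (v ^+ 3 * expR (1 * v))))).
  rewrite ler_pM//; last by apply: le_trans q_bound; exact: normr_sin_le.
  apply: (le_trans (normr_sinh_le _)).
  rewrite (_ : e * _ = M * x * expR (M * v)); last by rewrite /x; ring.
  by rewrite ler_pM ?expR_ge0// normrM (ger0_norm x0) ler_wpM2r.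
rewrite (_ : _ * _ = e ^+ 2 * (M * (v ^+ 4 * expR ((M + 1) * v)))).
  rewrite ler_wpM2l ?sqr_ge0// ler_wpM2l ?M0//.
  by apply: absorb; lra.
by rewrite (mulrDl M) expRD; ring.
Qed.

End Laplace.

Lemma integrable0yD f g : integrable0y f -> integrable0y g ->
  integrable0y (fun x => f x + g x).
Proof.
move=> fi gi; rewrite /integrable0y (_ : _ \o _ = (EFin \o f) \+ (EFin \o g))%E//.
exact: integrableD.
Qed.

Lemma integral0yZ (a : R) f : integrable0y f ->
  integral0y (fun x => a * f x) = a * integral0y f.
Proof. by move=> fi; rewrite /integral0y RintegralZl. Qed.

(** A pointwise estimate at scale e yields one for integrals, with the extra
    factor e of the change of variables. *)
Lemma dist_integral0y_scale (e K : R) F g h : 0 < e -> continuous F ->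
  integrable0y g -> integrable0y h ->
  (forall v, 0 <= v -> `|F (e * v) - g v| <= K * h v) ->
  `|integral0y F - e * integral0y g| <= e * K * integral0y h.
Proof.
move=> e0 cF ig ih Fg.
have -> : integral0y F = integral0y (fun v => e * F (e * v)).
  exact: scale_Rintegral0y.
have iK := integrable0yZ K ih.
have iF : integrable0y (fun v => F (e * v)).
  apply: (@le_integrable0y _ (fun v => `|g v| + K * h v)).
  - move=> v; apply: continuous_comp; last exact: cF.
    by apply: cvgM; [exact: cvg_cst|exact: cvg_id].
  - move=> v v0; have := Fg v v0; have := ler_normD (g v) (F (e * v) - g v).
    by rewrite addrC subrK; lra.
  - by apply: integrable0yD => //; exact: integrable_norm.
rewrite -(mulrA e) -(integral0yZ K)// -(integral0yZ e ig) -(integral0yZ e iK).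
apply: dist_integral0y; rewrite ?integrable0yZ//; try exact: integrable0yZ.
by move=> v v0; rewrite -mulrBr normrM (ger0_norm (ltW e0)) ler_wpM2l ?Fg ?(ltW e0).
Qed.

Lemma normr_integral0y_scale (e K : R) F h : 0 < e -> continuous F ->
  integrable0y h -> (forall v, 0 <= v -> `|F (e * v)| <= K * h v) ->
  `|integral0y F| <= e * K * integral0y h.
Proof.
move=> e0 cF ih Fh.
have i0 : integrable0y (fun=> 0).
  by have := integrable0yZ 0 ih; congr integrable0y; apply/funext => v; rewrite mul0r.
have z0 : integral0y (fun=> 0) = 0.
  rewrite -[RHS](mul0r (integral0y h)) -integral0yZ//.
  by apply: eq_Rintegral => v _; rewrite mul0r.
have := @dist_integral0y_scale e K F (fun=> 0) h e0 cF i0 ih.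
rewrite z0 mulr0 subr0; apply => v v0.
by rewrite subr0 Fh.
Qed.

Lemma laplace_integrals (M c s : R) : 0 < c -> c <= 1 -> `|s| <= 1 ->
  exists2 C, 0 <= C & forall y e r, 0 < e -> e <= 1 -> y * e ^+ 2 = 1 -> `|r| <= M ->
  `|expR (y * c) * integral0y (kernelX y c s r (y * s)) -
     e * Num.sqrt (pi / (2 * c))| <= C * e ^+ 3 /\
  `|expR (y * c) * integral0y (kernelY y c s r (y * s))| <= C * e ^+ 3.
Proof.
move=> c0 c1 s1.
pose h v := (M ^+ 2 + 2) * expR ((M + 8) * v - c / 2 * v ^+ 2).
have ih : integrable0y h by apply: integrable0y_gauss; rewrite divr_gt0.
have ig : integrable0y (fun v => expR (- (c / 2 * v ^+ 2))).
  have := @integrable0y_gauss 1 0 (c / 2) (divr_gt0 c0 (ltr0Sn _ _)).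
  by congr integrable0y; apply/funext => v; rewrite mul1r mul0r add0r.
exists (integral0y h).
  apply: Rintegral_ge0 => v _; rewrite mulr_ge0 ?expR_ge0//.
  by have := sqr_ge0 M; lra.
move=> y e r e0 e1 ye rM.
have y0 : 0 < y by have := @ltr01 R; rewrite -ye pmulr_lgt0// exprn_gt0.
rewrite -!integral0yZ; [|exact: integrable_kernelY|exact: integrable_kernelX].
have -> : integral0y h * e ^+ 3 = e * e ^+ 2 * integral0y h by ring.
have iK (k : R -> R) : continuous k -> continuous (fun u => expR (y * c) * k u).
  by move=> ck u; apply: cvgM; [exact: cvg_cst|exact: ck].
split.
  rewrite -integral0y_gauss_scaled//; apply: dist_integral0y_scale => //.
    by apply: iK; exact: continuous_kernelX.
  by move=> v v0; exact: kernelX_laplace.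
apply: normr_integral0y_scale => //.
  by apply: iK; exact: continuous_kernelY.
by move=> v v0; exact: kernelY_laplace.
Qed.

(** * The Airy regime *)

(** Here e = y^(-1/3), the line of integration has height pi / 2 - e, and
    x = e v.  The relation y e^3 = 1 balances the quadratic decay
    y e x^2 = v^2 with the cubic phase y x^3 = v^3; the remaining terms of the
    Taylor expansions are of fifth order in e, so that even after
    multiplication by y they are O(e^2). *)
Section Airy.
Variables (M y e r v : R).
Hypotheses (e0 : 0 < e) (e1 : e <= 1) (ye : y * e ^+ 3 = 1).
Hypotheses (rM : `|r| <= M) (v0 : 0 <= v).

Let M0 : 0 <= M. Proof. exact: le_trans rM. Qed.
Let y0 : 0 < y.
Proof. by have := @ltr01 R; rewrite -ye pmulr_lgt0// exprn_gt0. Qed.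
Let x := e * v.
Let x0 : 0 <= x. Proof. by rewrite mulr_ge0// ltW. Qed.
Let xv : x <= v. Proof. by rewrite ler_piMl. Qed.
Let W := expR ((M + 6) * v).
(* p and q are the exponent and the phase of the kernel, p0 and q0 their limits.
   The envelope g of expR p has 5 / 12 in place of 1 / 2: the difference pays
   for the product of the cubic term of sin e with the quadratic one of cosh x. *)
Let g := expR (1 / 6 - 5 / 12 * v ^+ 2).
Let p := y * e - y * sin e * cosh x.
Let p0 := 1 / 6 - v ^+ 2 / 2.
Let q := y * x - y * cos e * sinh x.
Let q0 := v / 2 - v ^+ 3 / 6.

Let absorb n (a : R) : n%:R + a <= M + 6 -> v ^+ n * expR (a * v) <= W.
Proof.
move=> na; apply: (@le_trans _ _ (expR (n%:R * v) * expR (a * v))).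
  by rewrite ler_wpM2r ?expR_ge0// exprn_le_expR.
by rewrite -expRD ler_expR -mulrDl ler_wpM2r.
Qed.

Let absorb1 n : n%:R <= (5 : R) -> v ^+ n * expR x <= W.
Proof.
move=> n5; apply: (@le_trans _ _ (v ^+ n * expR (1 * v))).
  by rewrite ler_wpM2l ?exprn_ge0// ler_expR mul1r.
by apply: absorb; have := M0; lra.
Qed.

Let absorb0 n : n%:R <= (5 : R) -> v ^+ n <= W.
Proof.
move=> n5; rewrite -[leLHS]mulr1 -expR0 -(mul0r v).
by apply: absorb; have := M0; lra.
Qed.

Let expR_p : expR p <= g.
Proof.
rewrite ler_expR /p.
have h1 := sin_ge_cubic (ltW e0).
have h2 := cosh_ge_quad x0.
have h3 : (y * (e - e ^+ 3 / 6)) * (1 + x ^+ 2 / 2) <= y * sin e * cosh x.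
  rewrite ler_pM//.
  - rewrite mulr_ge0 ?(ltW y0)// (_ : _ - _ = e * (1 - e ^+ 2 / 6)); last by field.
    rewrite mulr_ge0 ?(ltW e0)//.
    have : e ^+ 2 <= 1 by rewrite exprn_ile1 ?(ltW e0).
    by lra.
  - by have := sqr_ge0 x; lra.
  - by rewrite ler_wpM2l ?(ltW y0).
have h4 : (y * (e - e ^+ 3 / 6)) * (1 + x ^+ 2 / 2) =
    y * e + (y * e ^+ 3) * (v ^+ 2 / 2 - 1 / 6 - e ^+ 2 * v ^+ 2 / 12).
  by rewrite /x; field.
have h5 : e ^+ 2 * v ^+ 2 <= v ^+ 2.
  by rewrite ler_piMl ?sqr_ge0// exprn_ile1 ?(ltW e0).
by move: h3; rewrite h4 ye; lra.
Qed.

Let expR_p0 : expR p0 <= g.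
Proof. by rewrite ler_expR /p0; have := sqr_ge0 v; lra. Qed.

Let normr_add3_le (a b c : R) : `|a| <= e ^+ 2 * W -> `|b| <= e ^+ 2 * W ->
  `|c| <= e ^+ 2 * W -> `|a + b + c| <= e ^+ 2 * (3 * W).
Proof.
move=> ha hb hc; have := ler_normD (a + b) c; have := ler_normD a b; lra.
Qed.

Let dist_p : `|p - p0| <= e ^+ 2 * (3 * W).
Proof.
have -> : p - p0 = y * (e - e ^+ 3 / 6 - sin e) * cosh x +
    - (y * (e - e ^+ 3 / 6) * (cosh x - 1 - x ^+ 2 / 2)) + x ^+ 2 / 12.
  suff -> : p0 = (y * e ^+ 3) / 6 - (y * e ^+ 3) * v ^+ 2 / 2
      - (1 - y * e ^+ 3) * x ^+ 2 / 12 by rewrite /p /x; field.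
  by rewrite ye /p0; field.
have h1 := sin_ge_cubic (ltW e0).
have h2 := sin_le_quintic (ltW e0).
have h3 := cosh_ge1 x0.
have e5 : 0 <= e ^+ 5 by rewrite exprn_ge0 ?(ltW e0).
apply: normr_add3_le.
- rewrite (normrM (y * _)) (normrM y) (ger0_norm (ltW y0)).
  rewrite (ger0_norm (x := cosh x)); last by lra.
  apply: (@le_trans _ _ (y * e ^+ 5 * expR x)).
    apply: ler_pM; last exact: cosh_le_expR.
    - by rewrite mulr_ge0 ?(ltW y0).
    - by lra.
    - by rewrite ler_wpM2l ?(ltW y0)// ler_norml; apply/andP; split; lra.
  rewrite (_ : y * e ^+ 5 = y * e ^+ 3 * e ^+ 2); last by ring.
  rewrite ye mul1r ler_wpM2l ?sqr_ge0//.
  by have := @absorb1 0; rewrite expr0 mul1r; apply; lra.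
- have d0 : 0 <= e - e ^+ 3 / 6.
    rewrite (_ : _ - _ = e * (1 - e ^+ 2 / 6)); last by field.
    rewrite mulr_ge0 ?(ltW e0)//.
    have : e ^+ 2 <= 1 by rewrite exprn_ile1 ?(ltW e0).
    by lra.
  have c0 : 0 <= cosh x - 1 - x ^+ 2 / 2 by have := cosh_ge_quad x0; lra.
  rewrite normrN ger0_norm ?mulr_ge0 ?(ltW y0)//.
  apply: (@le_trans _ _ (y * e * (x ^+ 4 * expR x))).
    apply: ler_pM => //; last exact: cosh_subquad_le.
    - by rewrite mulr_ge0 ?(ltW y0).
    - rewrite ler_wpM2l ?(ltW y0)//.
      have : 0 <= e ^+ 3 by rewrite exprn_ge0 ?(ltW e0).
      by lra.
  rewrite (_ : y * e * _ = y * e ^+ 3 * (e ^+ 2 * (v ^+ 4 * expR x))); last first.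
    by rewrite /x; ring.
  by rewrite ye mul1r ler_wpM2l ?sqr_ge0// absorb1; lra.
- rewrite ger0_norm ?divr_ge0 ?sqr_ge0//.
  apply: (@le_trans _ _ (e ^+ 2 * v ^+ 2)).
    by rewrite -exprMn -/x; have := sqr_ge0 x; lra.
  by rewrite ler_wpM2l ?sqr_ge0// absorb0; lra.
Qed.

Let dist_q : `|q - q0| <= e ^+ 2 * (3 * W).
Proof.
have -> : q - q0 = - (y * (cos e - 1 + e ^+ 2 / 2) * sinh x) +
    - (y * (1 - e ^+ 2 / 2) * (sinh x - x - x ^+ 3 / 6)) + y * e ^+ 2 * x ^+ 3 / 12.
  suff -> : q0 = (y * e ^+ 3) * v / 2 - (y * e ^+ 3) * v ^+ 3 / 6
    by rewrite /q /x; field.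
  by rewrite ye /q0; field.
have h1 := cos_ge_quad (ltW e0).
have h2 := cos_le_quartic (ltW e0).
have h3 := sinh_ge0 x0.
have e4 : 0 <= e ^+ 4 by rewrite exprn_ge0 ?(ltW e0).
apply: normr_add3_le.
- have cf0 : 0 <= y * (cos e - 1 + e ^+ 2 / 2).
    by rewrite mulr_ge0 ?(ltW y0)//; lra.
  rewrite normrN (ger0_norm (mulr_ge0 cf0 h3)).
  apply: (@le_trans _ _ (y * e ^+ 4 * (x * expR x))).
    apply: ler_pM => //; last exact: sinh_le.
    - by rewrite ler_wpM2l ?(ltW y0)//; lra.
  rewrite (_ : y * e ^+ 4 * _ =
    y * e ^+ 3 * (e ^+ 2 * (v ^+ 1 * expR x))); last by rewrite /x; ring.
  by rewrite ye mul1r ler_wpM2l ?sqr_ge0// absorb1; lra.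
- have e2 : e ^+ 2 <= 1 by rewrite exprn_ile1 ?(ltW e0).
  have s0 : 0 <= sinh x - x - x ^+ 3 / 6 by have := sinh_ge_cubic x0; lra.
  have cf0 : 0 <= y * (1 - e ^+ 2 / 2) by rewrite mulr_ge0 ?(ltW y0)//; lra.
  rewrite normrN (ger0_norm (mulr_ge0 cf0 s0)).
  apply: (@le_trans _ _ (y * 1 * (x ^+ 5 * expR x))).
    apply: ler_pM => //; last exact: sinh_subcubic_le.
    - by rewrite ler_wpM2l ?(ltW y0)//; have := sqr_ge0 e; lra.
  rewrite (_ : y * 1 * _ = y * e ^+ 3 * (e ^+ 2 * (v ^+ 5 * expR x))); last first.
    by rewrite /x; ring.
  by rewrite ye mul1r ler_wpM2l ?sqr_ge0// absorb1; lra.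
- rewrite (_ : y * e ^+ 2 * _ / 12 =
    y * e ^+ 3 * (e ^+ 2 * (v ^+ 3 / 12))); last by rewrite /x; ring.
  have v3 : 0 <= v ^+ 3 by rewrite exprn_ge0.
  rewrite ye mul1r ger0_norm ?(mulr_ge0 (sqr_ge0 e)) ?divr_ge0//.
  rewrite ler_wpM2l ?sqr_ge0//.
  by have := @absorb0 3; lra.
Qed.

Lemma kernelX_airy :
  `|expR (y * e) * kernelX y (sin e) (cos e) r y x -
    expR (1 / 6 - v ^+ 2 / 2) * cos (v / 2 - v ^+ 3 / 6)| <=
  e ^+ 2 * ((M ^+ 2 + 6) * expR (1 / 6) * expR ((M + 6) * v - 5 / 12 * v ^+ 2)).
Proof.
rewrite /kernelX -/q -/q0 mulrA -expRD -/p -/p0.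
have -> : (M ^+ 2 + 6) * expR (1 / 6) * expR ((M + 6) * v - 5 / 12 * v ^+ 2) =
    (M ^+ 2 + 6) * W * g.
  by rewrite /W /g !expRD; ring.
rewrite (_ : e ^+ 2 * _ = (e ^+ 2 * (M ^+ 2 * W) +
  e ^+ 2 * (3 * W) + e ^+ 2 * (3 * W)) * g); last by ring.
apply: dist_three_factors => //.
- by rewrite expR_ge0 expR_p.
- exact: normr_cos_le1.
- exact: normr_cos_le1.
- apply: (le_trans (normr_cosh_sub1 _)).
  apply: (@le_trans _ _ (e ^+ 2 * (M ^+ 2 * (v ^+ 2 * expR (M * v))))).
    rewrite (_ : e ^+ 2 * _ = (M * x) ^+ 2 * expR (M * v)); last by rewrite /x; ring.
    rewrite ler_pM ?sqr_ge0 ?expR_ge0//.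
      rewrite -[leLHS]ger0_norm ?sqr_ge0// normrX.
      have rMx : `|r * x| <= M * x by rewrite normrM (ger0_norm x0) ler_wpM2r.
      apply: lerXn2r => //; rewrite nnegrE.
      by apply: mulr_ge0.
    by rewrite ler_expR normrM (ger0_norm x0) ler_pM.
  rewrite ler_wpM2l ?sqr_ge0// ler_wpM2l ?sqr_ge0//.
  by apply: absorb; lra.
- by apply: (le_trans (dist_cos _ _)).
- apply: (le_trans (dist_expR expR_p expR_p0)).
  by rewrite ler_wpM2r ?expR_ge0.
Qed.

(** Only sinh (r x) is small here: the phase q is of order 1. *)
Lemma kernelY_airy :
  `|expR (y * e) * kernelY y (sin e) (cos e) r y x| <=
  e * ((M ^+ 2 + 6) * expR (1 / 6) * expR ((M + 6) * v - 5 / 12 * v ^+ 2)).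
Proof.
rewrite /kernelY -/q mulrA -expRD -/p.
have -> : (M ^+ 2 + 6) * expR (1 / 6) * expR ((M + 6) * v - 5 / 12 * v ^+ 2) =
    (M ^+ 2 + 6) * W * g.
  by rewrite /W /g !expRD; ring.
rewrite (normrM (expR p)) (normrM (sinh _)) (ger0_norm (expR_ge0 p)).
apply: (@le_trans _ _ (g * (e * (M * W)))); last first.
  rewrite (_ : e * (_ * g) = g * (e * ((M ^+ 2 + 6) * W))); last by ring.
  rewrite ler_wpM2l ?expR_ge0// ler_wpM2l ?(ltW e0)// ler_wpM2r ?expR_ge0//.
  by have := sqr_ge0 (M - 1); have := sqr_ge0 M; lra.
rewrite ler_pM ?mulr_ge0//.
apply: (@le_trans _ _ (e * (M * v * expR (M * v)) * 1)).
  rewrite ler_pM//; last exact: normr_sin_le1.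
  apply: (le_trans (normr_sinh_le _)).
  rewrite (_ : e * _ = M * x * expR (M * v)); last by rewrite /x; ring.
  have rMx : `|r * x| <= M * x by rewrite normrM (ger0_norm x0) ler_wpM2r.
  by rewrite ler_pM ?expR_ge0// ler_expR (le_trans rMx)// ler_wpM2l.
rewrite mulr1 ler_wpM2l ?(ltW e0)// -mulrA ler_wpM2l//.
by have := @absorb 1 M; rewrite expr1; apply; lra.
Qed.

End Airy.

(** * The limiting Airy integral *)

(** The function exp (- i z^3 / 6) is integrated along z = v - i h s v, v >= 0.
    At s = 0 this is the half line of height -1, at s = pi / 2 the ray with
    slope - k = - 1 / sqrt 3 on which - i z^3 is real and negative.  The height
    is a convex combination of 1 and k v for every real s, thanks to the
    squares of cos s and sin s: the parameter thus ranges over an open interval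
    containing both ends.  The starting point z = - i h s 0 moves on the
    imaginary axis, where exp (- i z^3 / 6) is real; so dz/ds, which is purely
    imaginary, contributes nothing to the real part. *)
Section AiryRotation.
Variable k : R.
Hypotheses (k0 : 0 < k) (k3 : 3 * k ^+ 2 = 1).

Let a (s : R) := cos s ^+ 2.
Let b (s : R) := k * sin s ^+ 2.
Let a' (s : R) := - (2 * cos s * sin s).
Let b' (s : R) := k * (2 * sin s * cos s).
Let h s v := a s + b s * v.
Let h' s v := a' s + b' s * v.
(* A and B are the real and imaginary parts of - i z^3 / 6, P and Q the real
   parts of exp (- i z^3 / 6) times dz/dv = 1 - i b and dz/ds = - i h'. *)
Let A s v := - (3 * v ^+ 2 * h s v - h s v ^+ 3) / 6.
Let B s v := - (v ^+ 3 - 3 * v * h s v ^+ 2) / 6.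
Let P s v := expR (A s v) * (cos (B s v) + b s * sin (B s v)).
Let Q s v := expR (A s v) * (h' s v * sin (B s v)).
Let D s v := expR (A s v) *
  (- ((v ^+ 2 - h s v ^+ 2) * h' s v / 2) * (cos (B s v) + b s * sin (B s v))
   + v * h s v * h' s v * (b s * cos (B s v) - sin (B s v))
   + b' s * sin (B s v)).

Let der_P s v : der (P ^~ v) s (D s v).
Proof. by rewrite /P /D /A /B /h /h' /a /b /a' /b'; derive; field. Qed.

Let der_Q s v : der (Q s) v (D s v).
Proof. by rewrite /Q /D /A /B /h; derive; field. Qed.

Let continuous_P s : continuous (P s).
Proof. rewrite /P /A /B /h; cont. Qed.

Let continuous_D s : continuous (D s).
Proof. rewrite /D /h' /A /B /h; cont. Qed.

Let k1 : k <= 1.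
Proof. by have := k0; have := k3; rewrite leNgt => *; apply/negP => ?; nra. Qed.

Let k2 : 1 / 2 <= k.
Proof. by have := k0; have := k3; rewrite leNgt => *; apply/negP => ?; nra. Qed.

Let cs (s : R) : cos s ^+ 2 = 1 - sin s ^+ 2.
Proof. by rewrite -(cos2Dsin2 s) addrK. Qed.

Let h_ge s v : 0 <= v -> (h s v >= 0) * (v <= 1 -> h s v <= 1) *
  (1 <= v -> 1 / 2 <= h s v) * (1 <= v -> h s v <= v) * (h s v <= 1 + v).
Proof.
move=> v0; rewrite /h /a /b cs.
have k0' := k0; have k1' := k1; have k2' := k2.
have b0 := sqr_ge0 (sin s); have a0 := sqr_ge0 (cos s); rewrite cs in a0.
set be := sin s ^+ 2 in a0 b0 *.
have kv : k * v <= v by rewrite ler_piMl.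
have kv0 : 0 <= k * v by rewrite mulr_ge0// ltW.
have e : 1 - be + k * be * v = (1 - be) * 1 + be * (k * v) by ring.
rewrite e.
have m1 (z : R) : 1 <= z -> k * v <= z -> (1 - be) * 1 + be * (k * v) <= z.
  move=> z1 z2; have := ler_wpM2l a0 z1; have := ler_wpM2l b0 z2; lra.
split; [split; [split; [split|]|]|].
- by rewrite addr_ge0// mulr_ge0.
- by move=> v1; apply: m1; lra.
- move=> v1; have z2 : 1 / 2 <= k * v.
    by rewrite (le_trans k2')// ler_peMr// ltW.
  have := ler_wpM2l b0 z2; lra.
- by move=> v1; apply: m1.
- by apply: m1; lra.
Qed.

(* A = - h (3 v^2 - h^2) / 6, where h lies between 1 and k v: for v <= 1 the
   exponent is at most 1 / 6, for v >= 1 it is at most - v^2 / 6. *)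
Let A_bound s v : 0 <= v -> A s v <= 1 / 3 - v ^+ 2 / 6.
Proof.
move=> v0; have H := h_ge s v0.
have h0 : 0 <= h s v by rewrite H.
rewrite /A; set z := h s v in H h0 *.
have [v1|v1] := leP v 1.
  have z1 : z <= 1 by rewrite H.
  have z3 : z ^+ 3 <= 1 by rewrite exprn_ile1.
  have vz : 0 <= v ^+ 2 * z by rewrite mulr_ge0 ?sqr_ge0.
  have v2 : v ^+ 2 <= 1 by rewrite exprn_ile1.
  by lra.
have z1 : 1 / 2 <= z by rewrite H// ltW.
have zv : z <= v by rewrite H// ltW.
have z2 : z ^+ 2 <= v ^+ 2 by rewrite lerXn2r ?nnegrE.
have : 1 / 2 * (2 * v ^+ 2) <= z * (3 * v ^+ 2 - z ^+ 2).
  by rewrite ler_pM ?mulr_ge0 ?sqr_ge0//; lra.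
by rewrite (exprS z 2); lra.
Qed.

Let b_bound s : `|b s| <= 1.
Proof.
rewrite /b normrM (ger0_norm (ltW k0)) normrX mulr_ile1 ?exprn_ge0 ?(ltW k0) ?k1//.
by rewrite exprn_ile1// normr_sin_le1.
Qed.

Let h'_bound s v : 0 <= v -> `|h' s v| <= 2 * (1 + v).
Proof.
move=> v0.
have cs2 : `|2 * cos s * sin s| <= 2.
  rewrite (normrM (2 * _)) (normrM 2) normr_nat -mulrA -[leRHS]mulr1 ler_wpM2l//.
  by rewrite mulr_ile1 ?normr_cos_le1 ?normr_sin_le1.
apply: (le_trans (ler_normD _ _)); rewrite mulrDr mulr1 lerD//.
  by rewrite normrN.
rewrite normrM (ger0_norm v0) ler_wpM2r// /b' normrM (ger0_norm (ltW k0)).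
by rewrite mulrAC -[leRHS]mul1r ler_pM ?(ltW k0) ?k1.
Qed.

Let trig_bound s (x : R) : `|cos x + b s * sin x| <= 2 /\ `|b s * cos x - sin x| <= 2.
Proof.
have l1 (z w : R) : `|z| <= 1 -> `|w| <= 1 -> `|z * w| <= 1.
  by move=> *; rewrite normrM mulr_ile1.
have c1 := normr_cos_le1 x; have s1 := normr_sin_le1 x.
have u1 := l1 _ _ (b_bound s) c1; have u2 := l1 _ _ (b_bound s) s1.
split.
  by apply: (le_trans (ler_normD _ _)); lra.
by apply: (le_trans (ler_normB _ _)); lra.
Qed.

Let G (v : R) := 8 * expR (1 / 3) * expR (3 * v - 1 / 6 * v ^+ 2).

Let G_bound (s v x : R) : 0 <= v -> `|x| <= 8 * (1 + v) ^+ 3 ->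
  `|expR (A s v) * x| <= G v.
Proof.
move=> v0 hx; rewrite normrM (ger0_norm (expR_ge0 _)).
apply: (@le_trans _ _ (expR (1 / 3 - v ^+ 2 / 6) * (8 * expR (3 * v)))).
  rewrite ler_pM ?expR_ge0 ?ler_expR ?A_bound// (le_trans hx)// ler_wpM2l//.
  rewrite mulrC expRM_natr lerXn2r ?nnegrE ?expR_ge0 ?addr_ge0//.
  exact: expR_ge1Dx.
rewrite /G le_eqVlt; apply/orP; left; apply/eqP.
by rewrite !expRD (_ : - (v ^+ 2 / 6) = - (1 / 6 * v ^+ 2)); [ring|field].
Qed.

Let P_bound s v : 0 <= v -> `|P s v| <= G v.
Proof.
move=> v0; apply: G_bound => //.
have [h1 _] := trig_bound s (B s v); apply: (le_trans h1).
have : 1 <= (1 + v) ^+ 3 by rewrite exprn_ege1//; lra.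
by lra.
Qed.

Let pow_le (v : R) : 0 <= v -> 1 + v <= (1 + v) ^+ 3.
Proof.
move=> v0; rewrite -[leLHS]mulr1 (exprS _ 2) ler_wpM2l//; first by lra.
by rewrite exprn_ege1//; lra.
Qed.

Let Q_bound s v : 0 <= v -> `|Q s v| <= G v.
Proof.
move=> v0; apply: G_bound => //; rewrite normrM.
have h1 := h'_bound s v0.
apply: (@le_trans _ _ (2 * (1 + v) * 1)).
  by rewrite ler_pM// normr_sin_le1.
by have := pow_le v0; lra.
Qed.

Let D_bound s v : 0 <= v -> `|D s v| <= G v.
Proof.
move=> v0; apply: G_bound => //.
have h1 := h'_bound s v0.
have [t1 t2] := trig_bound s (B s v).
have H := h_ge s v0.
have h0 : 0 <= h s v by rewrite H.
have hv : h s v <= 1 + v by rewrite H.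
have p3 := pow_le v0.
have w1 : `|v ^+ 2 - h s v ^+ 2| <= (1 + v) ^+ 2.
  have q1 : h s v ^+ 2 <= (1 + v) ^+ 2 by rewrite lerXn2r ?nnegrE//; lra.
  have q2 : v ^+ 2 <= (1 + v) ^+ 2 by rewrite lerXn2r ?nnegrE//; lra.
  have := sqr_ge0 v; have := sqr_ge0 (h s v).
  by rewrite ler_norml => *; apply/andP; split; lra.
have b1 : `|b' s * sin (B s v)| <= 2.
  rewrite normrM -[leRHS]mulr1 ler_pM ?normr_sin_le1//.
  rewrite /b' normrM (ger0_norm (ltW k0)) -[leRHS]mul1r ler_pM ?(ltW k0) ?k1//.
  rewrite (normrM (2 * _)) (normrM 2) normr_nat -mulrA -[leRHS]mulr1 ler_wpM2l//.
  by rewrite mulr_ile1 ?normr_cos_le1 ?normr_sin_le1.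
have r1 : `|- ((v ^+ 2 - h s v ^+ 2) * h' s v / 2) * (cos (B s v) + b s * sin (B s v))|
    <= 2 * (1 + v) ^+ 3.
  rewrite normrM normrN.
  have -> : 2 * (1 + v) ^+ 3 = ((1 + v) ^+ 2 * (2 * (1 + v)) / 2) * 2 by field.
  rewrite ler_pM// normrM ler_pM ?mulr_ge0//; last by rewrite ger0_norm.
  by rewrite normrM ler_pM.
have r2 : `|v * h s v * h' s v * (b s * cos (B s v) - sin (B s v))| <= 4 * (1 + v) ^+ 3.
  rewrite normrM (_ : 4 * _ = ((1 + v) * (1 + v) * (2 * (1 + v))) * 2); last by ring.
  rewrite ler_pM// normrM ler_pM// normrM (ger0_norm v0) (ger0_norm h0) ler_pM//.
  by lra.
apply: (le_trans (ler_normD _ _)).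
have := ler_normD
  (- ((v ^+ 2 - h s v ^+ 2) * h' s v / 2) * (cos (B s v) + b s * sin (B s v)))
  (v * h s v * h' s v * (b s * cos (B s v) - sin (B s v))).
by lra.
Qed.

Lemma airy_rotation :
  integral0y (fun v => expR (1 / 6 - v ^+ 2 / 2) * cos (v / 2 - v ^+ 3 / 6)) =
  integral0y (fun v => expR (- (4 * k / 9 * v ^+ 3))).
Proof.
have p0 := @pi_gt0 R.
have G16 : (0 : R) < 1 / 6 by rewrite divr_gt0.
have iG : integrable0y G by exact: integrable0y_gauss.
have inv : integral0y (P 0) = integral0y (P (pi / 2)).
  apply: (@green_integral0y (- pi) pi P D Q G).
  - move=> s _; apply: (@le_integrable0y (P s) G) => //.
    by move=> v; exact: P_bound.
  - by move=> s v _; exact: der_P.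
  - by move=> s v _; exact: der_Q.
  - by move=> s _; exact: continuous_D.
  - by move=> s v _ v0; exact: D_bound.
  - by move=> v; rewrite /G !mulr_ge0 ?expR_ge0.
  - exact: iG.
  - move=> s _; have B0 : B s 0 = 0 by rewrite /B; ring.
    by rewrite /Q B0 sin0 !mulr0.
  - by move=> s _; apply: (cvg0_gauss_bound G16) => v v0; exact: Q_bound.
  - by rewrite oppr_lt0 p0.
  - by apply/andP; split; lra.
transitivity (integral0y (P 0)).
  apply: eq_Rintegral => v _; rewrite /P /A /B /h /a /b cos0 sin0.
  rewrite (_ : k * 0 ^+ 2 = 0); last by ring.
  by rewrite !mul0r !addr0 !expr1n; congr (expR _ * cos _); field.
rewrite inv; apply: eq_Rintegral => v _; rewrite /P /A /B /h /a /b cos_pihalf sin_pihalf.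
rewrite expr0n expr1n mulr1 add0r.
have -> : - (v ^+ 3 - 3 * v * (k * v) ^+ 2) / 6 = v ^+ 3 * (3 * k ^+ 2 - 1) / 6 by field.
rewrite k3 subrr mulr0 mul0r cos0 sin0 mulr0 addr0 mulr1; congr expR.
have -> : - (3 * v ^+ 2 * (k * v) - (k * v) ^+ 3) / 6 =
  - (k * v ^+ 3 * (9 - 3 * k ^+ 2)) / 18 by field.
by rewrite k3; field.
Qed.

End AiryRotation.

Lemma bigcup_exhaust0y (c : R) m : 0 < c ->
  \bigcup_n `[c * n.+1%:R^-1 ^+ m.+1, c * n.+1%:R ^+ m.+1]%classic = `]0%R, +oo[%classic.
Proof.
move=> c0; apply/seteqP; split => x /=.
  move=> [n _] /=; rewrite !in_itv/= andbT => /andP[+ _].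
  by apply: lt_le_trans; rewrite mulr_gt0// exprn_gt0// invr_gt0 ltr0Sn.
rewrite in_itv/= andbT => x0.
have pw (z : R) : 1 <= z -> z <= z ^+ m.+1.
  by move=> z1; rewrite exprS ler_peMr ?exprn_ege1// (le_trans ler01).
have [n /= hn] : exists n, x / c + c / x <= n.+1%:R :> R.
  exists (Num.truncn (x / c + c / x)).
  by rewrite ltW// truncnS_gt.
have n1 : 1 <= n.+1%:R :> R by rewrite ler1n.
have x1 : 0 < x / c by rewrite divr_gt0.
have x2 : 0 < c / x by rewrite divr_gt0.
exists n => //=; rewrite in_itv/=; apply/andP; split.
- rewrite exprVn ler_pdivrMr ?exprn_gt0// mulrC -ler_pdivrMr//.
  apply: le_trans (pw _ n1); apply: le_trans hn.
  by lra.
- rewrite mulrC -ler_pdivrMr//; apply: le_trans (pw _ n1); apply: le_trans hn.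
  by lra.
Qed.

Lemma der_derive1 f (x a : R) : der f x a -> f^`()%classic x = a.
Proof. by rewrite /der derive1E => df; rewrite derive_val. Qed.

Lemma integrable0y_expR_cubic (c : R) : 0 < c ->
  integrable0y (fun v => expR (- (c * v ^+ 3))).
Proof.
move=> c0; apply: le_integrable0y (integrable0y_gauss (expR c) 0 c0).
  by cont.
move=> v v0; rewrite ger0_norm ?expR_ge0// -expRD ler_expR mul0r add0r.
suff : c * (v ^+ 2 - 1) <= c * v ^+ 3 by lra.
rewrite ler_wpM2l ?(ltW c0)//.
have : 0 <= (v + 1) * (v - 1) ^+ 2 by rewrite mulr_ge0 ?sqr_ge0//; lra.
by lra.
Qed.

(** The substitution u = c v^3.  The integrand of Gamma is unbounded near 0, so
    the two integrals are first compared over compact subintervals of ]0, +oo[,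
    which exhaust it, and then monotone convergence applies. *)
Lemma Gamma_third (c : R) : 0 < c ->
  Gamma (1 / 3) = 3 * powR c (1 / 3) * integral0y (fun v => expR (- (c * v ^+ 3))).
Proof.
move=> c0.
pose F v : R := c * v ^+ 3.
pose f u : R := powR u (1 / 3 - 1) * expR (- u).
pose g v : R := 3 * powR c (1 / 3) * expR (- (c * v ^+ 3)).
have dF v : der F v (3 * c * v ^+ 2) by rewrite /F; derive; ring.
have dFE : F^`()%classic = (fun v => 3 * c * v ^+ 2).
  by apply/funext => v; exact: der_derive1.
have cF' : continuous (fun v : R => 3 * c * v ^+ 2) by cont.
have cF v : {for v, continuous F} := der_continuous (dF v).
have cg : continuous g by rewrite /g; cont.
have g0 v : 0 <= g v by rewrite /g !mulr_ge0 ?powR_ge0 ?expR_ge0.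
have f0 v : 0 <= f v by rewrite /f mulr_ge0 ?powR_ge0 ?expR_ge0.
have cf (u : R) : 0 < u -> {for u, continuous f}.
  move=> u0; apply: (@der_continuous _ _ _); apply: der_mul.
    exact: is_derive1_powR.
  by repeat derive_step.
have sub (a b : R) : 0 < a -> a <= b ->
    (\int[lebesgue_measure]_(u in `[F a, F b]) (f u)%:E =
     \int[lebesgue_measure]_(v in `[a, b]) (g v)%:E)%E.
  move=> a0 ab.
  have Fa0 : 0 < F a by rewrite /F mulr_gt0 ?exprn_gt0.
  rewrite (@integration_by_substitution_increasing R F f a b)//.
  - apply: eq_integral => v; rewrite inE/= in_itv/= => /andP[av _].
    have v0 : 0 < v by exact: lt_le_trans av.
    congr EFin; rewrite fctE dFE /f /g /= /F.
    rewrite powRM ?exprn_ge0 ?ltW// -powR_mulrn ?(ltW v0)// -powRrM.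
    rewrite (_ : 3%:R * (1 / 3 - 1) = - 2 :> R); last by field.
    rewrite powRB ?(gt_eqF c0) ?implybT// powRr1 ?(ltW c0)// powRN.
    have -> : powR v 2 = v ^+ 2 by rewrite -powR_mulrn// ltW.
    by field; rewrite !gt_eqF.
  - move=> v w; rewrite !in_itv/= => /andP[av _] /andP[aw _] vw.
    have v0 : 0 <= v by rewrite (le_trans _ av)// ltW.
    by rewrite /F ltr_pM2l// ltrXn2r// nnegrE (le_trans v0)// ltW.
  - by move=> v _; rewrite dFE; exact: cF'.
  - by rewrite dFE; apply/cvg_ex; eexists; apply: cvg_at_right_filter; exact: cF'.
  - by rewrite dFE; apply/cvg_ex; eexists; apply: cvg_at_left_filter; exact: cF'.
  - split.
    + by move=> v _; have := dF v; rewrite /der => ?; exact: ex_derive.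
    + by apply: cvg_at_right_filter; exact: cF.
    + by apply: cvg_at_left_filter; exact: cF.
  - apply: continuous_in_subspaceT => u; rewrite inE/= in_itv/= => /andP[Fu _].
    by apply: cf; exact: lt_le_trans Fu.
have mg (D : set R) : measurable_fun D (EFin \o g).
  apply/measurable_EFinP; apply: measurable_funTS.
  exact: continuous_measurable_fun.
have mf (D : set R) : measurable D -> D `<=` `]0%R, +oo[ -> measurable_fun D (EFin \o f).
  move=> mD D0; apply/measurable_EFinP.
  apply: (measurable_funS (measurable_itv `]0%R, +oo[)) => //.
  apply: open_continuous_measurable_fun => // u.
  by rewrite inE/= in_itv/= andbT; exact: cf.
pose I (m : nat) (k : R) (n : nat) :=
  `[k * n.+1%:R^-1 ^+ m.+1, k * n.+1%:R ^+ m.+1]%classic.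
have ndI m (k : R) : 0 < k -> nondecreasing_seq (I m k).
  move=> k0; apply/nondecreasing_seqP => n; rewrite subsetEset /I.
  apply: subset_itv; rewrite bnd_simp ler_wpM2l ?(ltW k0)// lerXn2r ?nnegrE ?invr_ge0//.
  - by rewrite lef_pV2 ?posrE ?ltr0Sn// ler_nat.
  - by rewrite ler_nat.
have I0 m (k : R) n : 0 < k -> I m k n `<=` `]0%R, +oo[.
  by move=> k0; rewrite -(bigcup_exhaust0y m k0); exact: bigcup_sup.
have limI m (k : R) (w : R -> R) : 0 < k -> (forall v, 0 <= w v) ->
    (forall n, measurable_fun (I m k n) (EFin \o w)) ->
    (\int[lebesgue_measure]_(v in I m k n) (w v)%:E)%E @[n --> \oo] -->
    (\int[lebesgue_measure]_(v in `]0%R, +oo[) (w v)%:E)%E.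
  move=> k0 w0 mw; rewrite -(bigcup_exhaust0y m k0).
  apply: ge0_nondecreasing_set_cvg_integral => //.
  + exact: ndI.
  + by move=> n; exact: measurable_itv.
  + by move=> n v _; rewrite lee_fin.
have lim_f := limI 2%N c f c0 f0 (fun n => mf _ (measurable_itv _) (I0 2%N c n c0)).
have lim_g := limI 0%N 1 g ltr01 g0 (fun n => mg _).
have E : (\int[lebesgue_measure]_(u in `]0%R, +oo[) (f u)%:E =
    \int[lebesgue_measure]_(v in `]0%R, +oo[) (g v)%:E)%E.
  have EI : (fun n => \int[lebesgue_measure]_(u in I 2%N c n) (f u)%:E)%E =
      (fun n => \int[lebesgue_measure]_(v in I 0%N 1%R n) (g v)%:E)%E.
    apply/funext => n; have n1 : 1 <= n.+1%:R :> R by rewrite ler1n.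
    have n0 : 0 < n.+1%:R^-1 :> R by rewrite invr_gt0 ltr0Sn.
    have nn : n.+1%:R^-1 <= n.+1%:R :> R by rewrite (le_trans _ n1)// invf_le1.
    by rewrite /I !mul1r !expr1 -(sub _ _ n0 nn).
  by move: lim_f; rewrite EI => lim_f; exact: (cvg_unique _ lim_f lim_g).
rewrite /Gamma /Rintegral E.
have ig := integrable0y_expR_cubic c0.
rewrite -integral0yZ// /integral0y /Rintegral integral_itv_obnd_cbnd//.
Qed.

Lemma airy_constant :
  integral0y (fun v => expR (1 / 6 - v ^+ 2 / 2) * cos (v / 2 - v ^+ 3 / 6)) =
  Gamma (1 / 3) / (powR 2 (2 / 3) * powR 3 (1 / 6)).
Proof.
pose k : R := powR 3 (- (1 / 2)).
have k0 : 0 < k by rewrite powR_gt0.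
have k3 : 3 * k ^+ 2 = 1.
  rewrite /k -powR_mulrn ?powR_ge0// -powRrM (_ : - (1 / 2) * 2%:R = - 1); last by field.
  by rewrite powRN powRr1// divff.
rewrite (airy_rotation k0 k3).
have c0 : 0 < 4 * k / 9 by rewrite divr_gt0// mulr_gt0.
rewrite (Gamma_third c0).
have -> : 4 * k / 9 = powR 2 2 * powR 3 (- (5 / 2)).
  have -> : powR 2 2 = 4 :> R by rewrite powR_mulrn//; ring.
  rewrite (_ : - (5 / 2) = - (1 / 2) - 2); last by field.
  rewrite powRB ?pnatr_eq0 ?implybT// -/k powR_mulrn// mulrA.
  by congr (_ / _); ring.
rewrite powRM ?powR_ge0// -!powRrM.
rewrite (_ : 2 * (1 / 3) = 2 / 3); last by field.
have -> : 3 * (powR 2 (2 / 3) * powR 3 (- (5 / 2) * (1 / 3))) =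
    powR 2 (2 / 3) * powR 3 (1 / 6) :> R.
  rewrite mulrCA; congr (_ * _); rewrite -{1}(@powRr1 _ 3)// -powRD ?pnatr_eq0 ?implybT//.
  by congr powR; field.
by rewrite mulrAC divff ?mul1r// gt_eqF// mulr_gt0 ?powR_gt0.
Qed.

(** The estimate of the real part is even O(e^3); the weaker error O(e^2) comes
    from the imaginary part. *)
Lemma airy_integrals (M : R) : 0 <= M ->
  exists2 C, 0 <= C & forall y e r, 0 < e -> e <= 1 -> y * e ^+ 3 = 1 -> `|r| <= M ->
  `|expR (y * e) * integral0y (kernelX y (sin e) (cos e) r y) -
     e * (Gamma (1 / 3) / (powR 2 (2 / 3) * powR 3 (1 / 6)))| <= C * e ^+ 2 /\
  `|expR (y * e) * integral0y (kernelY y (sin e) (cos e) r y)| <= C * e ^+ 2.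
Proof.
move=> M0.
pose h v := (M ^+ 2 + 6) * expR (1 / 6) * expR ((M + 6) * v - 5 / 12 * v ^+ 2).
have k0 : (0:R) < 5 / 12 by rewrite divr_gt0.
have ih : integrable0y h by exact: integrable0y_gauss.
have h0 : 0 <= integral0y h.
  apply: Rintegral_ge0 => v _; rewrite !mulr_ge0 ?expR_ge0//.
  by have := sqr_ge0 M; lra.
have ig : integrable0y (fun v => expR (1 / 6 - v ^+ 2 / 2) * cos (v / 2 - v ^+ 3 / 6)).
  have k1 : (0:R) < 1 / 2 by rewrite divr_gt0.
  apply: le_integrable0y (integrable0y_gauss (expR (1 / 6)) 0 k1).
    by cont.
  move=> v v0; rewrite normrM ger0_norm ?expR_ge0// -expRD.
  rewrite -[leRHS]mulr1 ler_pM ?expR_ge0 ?normr_cos_le1// ler_expR.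
  by lra.
exists (integral0y h) => // y e r e0 e1 ye rM.
have y0 : 0 < y by have := @ltr01 R; rewrite -ye pmulr_lgt0// exprn_gt0.
have se : 0 < sin e.
  have := sin_ge_cubic (ltW e0).
  have : 0 < e * (1 - e ^+ 2 / 6).
    rewrite mulr_gt0//; have : e ^+ 2 <= 1 by rewrite exprn_ile1 ?(ltW e0).
    by lra.
  by rewrite (_ : e * _ = e - e ^+ 3 / 6); [lra|field].
rewrite -!integral0yZ; [|exact: integrable_kernelY|exact: integrable_kernelX].
have iK (k : R -> R) : continuous k -> continuous (fun u => expR (y * e) * k u).
  by move=> ck u; apply: cvgM; [exact: cvg_cst|exact: ck].
split.
- rewrite -airy_constant.
  apply: (@le_trans _ _ (e * e ^+ 2 * integral0y h)).
    apply: dist_integral0y_scale => //.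
      by apply: iK; exact: continuous_kernelX.
    by move=> v v0; exact: kernelX_airy.
  by rewrite mulrC ler_wpM2l// ler_piMl ?sqr_ge0.
- have -> : integral0y h * e ^+ 2 = e * e * integral0y h by ring.
  apply: normr_integral0y_scale => //.
    by apply: iK; exact: continuous_kernelY.
  by move=> v v0; exact: kernelY_airy.
Qed.

(** * The two asymptotic formulas *)

Lemma normc_le (X Y B : R) : `|X| <= B -> `|Y| <= B -> `|X +i* Y| <= (2 * B)%:C.
Proof.
move=> XB YB; rewrite normc_def lecR/=.
have B0 : 0 <= B by exact: le_trans XB.
have sq (z : R) : `|z| <= B -> z ^+ 2 <= B ^+ 2.
  by move=> zB; rewrite -[z ^+ 2]ger0_norm ?sqr_ge0// normrX lerXn2r ?nnegrE.
rewrite -[leRHS]ger0_norm ?mulr_ge0// -sqrtr_sqr ler_wsqrtr//.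
by have := sq _ XB; have := sq _ YB; have := sqr_ge0 B; rewrite exprMn; lra.
Qed.

Lemma normc_real (x : R) : 0 <= x -> `|x%:C| = x%:C :> R[i].
Proof. by move=> x0; rewrite ger0_norm// -[0]/(0%:C) lecR. Qed.

Lemma normr_cexp (a b : R) : `|cexp (a +i* b)| = (expR a)%:C.
Proof.
rewrite /cexp/= normc_def/=; congr (_%:C).
by rewrite !exprMn -mulrDr cos2Dsin2 mulr1 sqrtr_sqr ger0_norm ?expR_ge0.
Qed.

Lemma cexpD (a b c d : R) :
  cexp (a +i* b) * cexp (c +i* d) = cexp ((a + c) +i* (b + d)).
Proof.
apply/eqP; rewrite eq_complex/= cosD sinD expRD.
by apply/andP; split; apply/eqP; ring.
Qed.

Lemma normr_cexp_sub1 (b : R) : `|cexp (0 +i* b) - 1| <= (2 * `|b|)%:C.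
Proof.
have -> : cexp (0 +i* b) - 1 = (cos b - 1) +i* sin b.
  by apply/eqP; rewrite eq_complex/= expR0 !mul1r subr0 !eqxx.
apply: normc_le; last exact: normr_sin_le.
by have := dist_cos b 0; rewrite cos0 subr0.
Qed.

Lemma powRN_le1 (y a : R) : 1 <= y -> 0 <= a -> 0 < powR y (- a) /\ powR y (- a) <= 1.
Proof.
move=> y1 a0; split; first by apply: powR_gt0; exact: lt_le_trans y1.
by rewrite -(powRr0 y) ler_powR// oppr_le0.
Qed.

(** The height of the line is theta, so that the prefactor of [besselK_shift]
    is exp (- y theta sin theta + i r theta). *)
Lemma besselK_laplace (M theta : R) : 0 <= theta -> theta < pi / 2 ->
  bigO_unif M
    (fun r y : R =>
       besselK (r +i* (y * sin theta)) y
       - (Num.sqrt (pi / (2 * y * cos theta)))%:C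
         * (expR (- (y * (cos theta + theta * sin theta))))%:C
         * cexp (0 +i* (r * theta)))
    (fun r y : R =>
       (powR y (- (3 / 2))
        * expR (- (y * (cos theta + theta * sin theta))))%:C).
Proof.
move=> t0 tpi; have p0 := @pi_gt0 R.
set c := cos theta; set s := sin theta.
have c0 : 0 < c by apply: cos_gt0_pihalf; apply/andP; split; lra.
have [C C0 HC] := @laplace_integrals M c s c0 (cos_le1 _) (normr_sin_le1 _).
exists (2 * C); near=> y => r rM.
have y1 : 1 <= y by near: y; exact: nbhs_pinfty_ge.
have y0 : 0 < y by exact: lt_le_trans y1.
pose e := powR y (- (1 / 2)).
have [e0 e1] : 0 < e /\ e <= 1 by apply: powRN_le1; rewrite // divr_ge0.
have ye : y * e ^+ 2 = 1.
  rewrite /e -powR_mulrn ?powR_ge0// -powRrM (_ : - (1 / 2) * 2%:R = - 1); last by field.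
  by rewrite powRN powRr1 ?(ltW y0)// divff// gt_eqF.
have e3 : powR y (- (3 / 2)) = e ^+ 3.
  rewrite /e -powR_mulrn ?powR_ge0// -powRrM; congr powR.
  by field.
have sq : Num.sqrt (pi / (2 * y * c)) = e * Num.sqrt (pi / (2 * c)).
  rewrite -[in RHS](ger0_norm (ltW e0)) -sqrtr_sqr -sqrtrM ?sqr_ge0//; congr Num.sqrt.
  rewrite (_ : e ^+ 2 = y^-1); first by field; rewrite !gt_eqF.
  by apply: (mulfI (lt0r_neq0 y0)); rewrite ye divff// gt_eqF.
have [HX HY] := HC y e r e0 e1 ye rM.
rewrite (@besselK_shift _ _ _ theta)//; last by rewrite t0.
rewrite -/c -/s sq e3.
set X := integral0y (kernelX y c s r (y * s)) in HX *.
set Y := integral0y (kernelY y c s r (y * s)) in HY *.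
set w := - (y * (c + theta * s)).
have wE : expR (- (y * s * theta)) = expR w * expR (y * c).
  by rewrite -expRD /w; congr expR; ring.
rewrite (_ : _ - _ = (expR w)%:C * (cexp (0 +i* (r * theta)) *
  ((expR (y * c) * X - e * Num.sqrt (pi / (2 * c))) +i* (expR (y * c) * Y)))); last first.
  apply/eqP; rewrite eq_complex/= wE expR0.
  by apply/andP; split; apply/eqP; ring.
rewrite !normrM normr_cexp expR0 mul1r.
rewrite !normc_real ?mulr_ge0 ?expR_ge0 ?exprn_ge0 ?(ltW e0)//.
rewrite (_ : _ * (_ * _)%:C = (expR w)%:C * (2 * (C * e ^+ 3))%:C); last first.
  by apply/eqP; rewrite eq_complex/=; apply/andP; split; apply/eqP; ring.
rewrite ler_wpM2l//; last exact: normc_le.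
by rewrite -[0]/(0%:C) lecR expR_ge0.
Unshelve. all: by end_near. Qed.

Lemma cexp_shift_phase (p y e r : R) :
  cexp (- (y * (p - e)) +i* (r * (p - e))) =
  cexp (- (p * y) +i* (p * r)) * ((expR (y * e))%:C * cexp (0 +i* - (r * e))).
Proof.
have -> : (expR (y * e))%:C = cexp (y * e +i* 0).
  by apply/eqP; rewrite eq_complex/= cos0 sin0 mulr0 mulr1 !eqxx.
rewrite cexpD cexpD; apply: (congr1 (@cexp R)); apply/eqP.
by rewrite eq_complex/=; apply/andP; split; apply/eqP; ring.
Qed.

Lemma factor_phase (A : comPzRingType) (m E c Z G : A) :
  m * (E * c) * Z - m * G = m * (c * (E * Z - G) + G * (c - 1)).
Proof. by ring. Qed.

(** The line has height pi / 2 - e.  The prefactor of [besselK_shift] differs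
    from the expected one by exp (y e), which the kernels absorb, and by
    exp (- i r e), which is 1 + O(e) uniformly in r. *)
Lemma besselK_airy (M : R) : 0 <= M ->
  bigO_unif M
    (fun r y : R =>
       besselK (r +i* y) y
       - cexp ((- (pi / 2 * y)) +i* (pi / 2 * r))
         * (powR y (- (1 / 3))
            * (Gamma (1 / 3) / (powR 2 (2 / 3) * powR 3 (1 / 6))))%:C)
    (fun r y : R =>
       (powR y (- (2 / 3)))%:C
       * cexp ((- (pi / 2 * y)) +i* (pi / 2 * r))).
Proof.
move=> M0; have p0 := @pi_gt0 R; have p2 := @pi_ge2 R.
have [C C0 HC] := airy_integrals M0.
set g := Gamma (1 / 3) / _ in HC *.
have g0 : 0 <= g.
  rewrite /g divr_ge0 ?mulr_ge0 ?powR_ge0//.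
  by apply: Rintegral_ge0 => u _; rewrite mulr_ge0 ?powR_ge0 ?expR_ge0.
exists (2 * C + 2 * M * g); near=> y => r rM.
have y1 : 1 <= y by near: y; exact: nbhs_pinfty_ge.
have y0 : 0 < y by exact: lt_le_trans y1.
pose e := powR y (- (1 / 3)).
have [e0 e1] : 0 < e /\ e <= 1 by apply: powRN_le1; rewrite // divr_ge0.
have ye : y * e ^+ 3 = 1.
  rewrite /e -powR_mulrn ?powR_ge0// -powRrM (_ : - (1 / 3) * 3%:R = - 1); last by field.
  by rewrite powRN powRr1 ?(ltW y0)// divff// gt_eqF.
have e2 : powR y (- (2 / 3)) = e ^+ 2.
  rewrite /e -powR_mulrn ?powR_ge0// -powRrM; congr powR.
  by field.
have [HX HY] := HC y e r e0 e1 ye rM.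
rewrite -/e e2 (@besselK_shift _ _ _ (pi / 2 - e))//; last by apply/andP; split; lra.
have -> : cos (pi / 2 - e) = sin e by rewrite cosB cos_pihalf sin_pihalf; ring.
have -> : sin (pi / 2 - e) = cos e by rewrite sinB cos_pihalf sin_pihalf; ring.
set X := integral0y (kernelX y _ _ r y) in HX *.
set Y := integral0y (kernelY y _ _ r y) in HY *.
set m := cexp (- (pi / 2 * y) +i* _).
rewrite cexp_shift_phase -/m.
rewrite (_ : _ - _ = m * (cexp (0 +i* - (r * e)) *
    ((expR (y * e) * X - e * g) +i* (expR (y * e) * Y))
  + (e * g)%:C * (cexp (0 +i* - (r * e)) - 1))); last first.
  rewrite (_ : (expR (y * e) * X - e * g) +i* (expR (y * e) * Y) =
      (expR (y * e))%:C * (X +i* Y) - (e * g)%:C); last first.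
    by apply/eqP; rewrite eq_complex/=; apply/andP; split; apply/eqP; ring.
  move: m (expR _)%:C (cexp _) (X +i* Y) (e * g)%:C => m' E' c' Z' G'.
  exact: factor_phase.
rewrite !normrM (normc_real (x := e ^+ 2)) ?exprn_ge0 ?(ltW e0)//.
rewrite [leRHS](mulrCA _ (e ^+ 2)%:C) [leRHS]mulrA [leRHS]mulrC ler_wpM2l//.
apply: (le_trans (ler_normD _ _)); rewrite !normrM normr_cexp expR0 mul1r.
rewrite (normc_real (mulr_ge0 (ltW e0) g0)).
apply: (@le_trans _ _ ((2 * (C * e ^+ 2))%:C + (e * g)%:C * (2 * (M * e))%:C)).
  rewrite lerD ?normc_le// ler_wpM2l//; first by rewrite -[0]/(0%:C) lecR mulr_ge0// ltW.
  apply: (le_trans (normr_cexp_sub1 _)); rewrite lecR ler_wpM2l// normrN normrM.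
  by rewrite (ger0_norm (ltW e0)) ler_wpM2r// ltW.
rewrite le_eqVlt; apply/orP; left; rewrite eq_complex/=.
by apply/andP; split; apply/eqP; ring.
Unshelve. all: by end_near. Qed.

End HalfLine.

Theorem theorem1p1 (R : realType) (M theta : R)
    (hM : 0 <= M) (htheta : 0 <= theta <= pi / 2) :
  (theta < pi / 2 ->
    bigO_unif M
      (fun r y : R =>
         besselK (r +i* (y * sin theta)) y
         - (Num.sqrt (pi / (2 * y * cos theta)))%:C
           * (expR (- (y * (cos theta + theta * sin theta))))%:C
           * cexp (0 +i* (r * theta)))
      (fun r y : R =>
         (powR y (- (3 / 2))
          * expR (- (y * (cos theta + theta * sin theta))))%:C))
  /\
  (theta = pi / 2 ->
    bigO_unif M
      (fun r y : R =>
         besselK (r +i* (y * sin theta)) y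
         - cexp ((- (pi / 2 * y)) +i* (pi / 2 * r))
           * (powR y (- (1 / 3))
              * (Gamma (1 / 3) / (powR 2 (2 / 3) * powR 3 (1 / 6))))%:C)
      (fun r y : R =>
         (powR y (- (2 / 3)))%:C
         * cexp ((- (pi / 2 * y)) +i* (pi / 2 * r)))).
Proof.
have [theta0 _] := andP htheta.
split => [theta_lt|->]; first exact: besselK_laplace.
rewrite sin_pihalf; have [C HC] := besselK_airy hM.
by exists C; near=> y; rewrite mulr1; near: y; exact: HC.
Unshelve. all: by end_near. Qed.
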